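(* Let $(W,S)$ be a Coxeter system of rank $n$ with Coxeter matrix $M=(m_{ij})_{i,j\in I}$, and let $w\in W$ be a Coxeter element. Suppose that either (i) $n=3$ and $\min\{m_{ij}\mid i\neq j,\ i,j\in I\}\geq 5$, or (ii) $n\geq 4$ and $\min\{m_{ij}\mid i\neq j,\ i,j\in I\}\geq 3$. Then $\lim_{\lambda\to\infty} l_R(w^\lambda)=\infty$.
   Context: A Coxeter system $(W,S)$ with $S=\{s_1,\dots,s_n\}$ is given by the presentation $W=\langle S\mid s_i^2=(s_is_j)^{m_{ij}}=1\ \forall i\neq j\rangle$ with $m_{ij}=m_{ji}\in\{2,3,\dots\}\cup\{\infty\}$ for $i\ne j$ (no relation when $m_{ij}=\infty$); $n=|S|$ is the rank. A Coxeter element is an element of the form $s_{\sigma(1)}\cdots s_{\sigma(n)}$ with $\sigma$ a permutation of $\{1,\dots,n\}$. The set of reflections is $R=\{wsw^{-1}\mid w\in W, s\in S\}$, and the reflection length $l_R(w)$ is the minimal number $q$ such that $w$ is a product of $q$ reflections ($l_R(1)=0$). *)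

(* Defs.v *)
(* Coxeter groups given by their presentation, realized
   as words in the generators modulo the congruence generated by the
   Coxeter relators. *)
From mathcomp Require Import all_boot all_fingroup.
From Stdlib Require Import Relation_Operators ClassicalEpsilon.
Set Implicit Arguments. Unset Strict Implicit. Unset Printing Implicit Defensive.

(* Coxeter matrix of rank n: m i j = Some k (k >= 2) or None (= infinity)
   for i <> j; symmetric. Diagonal entries are irrelevant (m_ii = 1). *)
Definition coxeter_matrix (n : nat) (m : 'I_n -> 'I_n -> option nat) : Prop :=
  (forall i j, m i j = m j i) /\
  (forall i j k, i != j -> m i j = Some k -> 2 <= k).

Definition word n := seq 'I_n.

Definition relator n (m : 'I_n -> 'I_n -> option nat) (r : word n) : Prop :=
  (exists i, r = [:: i; i]) \/
  (exists i j k, i != j /\ m i j = Some k /\ r = flatten (nseq k [:: i; j])).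

Inductive cox_step n (m : 'I_n -> 'I_n -> option nat) : word n -> word n -> Prop :=
  | CoxStep u v r : relator m r -> cox_step m (u ++ r ++ v) (u ++ v).

(* equality in W = < S | s_i^2 = (s_i s_j)^{m_ij} = 1 > *)
Definition coxeq n (m : 'I_n -> 'I_n -> option nat) : word n -> word n -> Prop :=
  clos_refl_sym_trans (word n) (cox_step m).

(* t represents a reflection x s x^{-1} (x^{-1} is the reversed word) *)
Definition is_reflection n (m : 'I_n -> 'I_n -> option nat) (t : word n) : Prop :=
  exists (x : word n) (s : 'I_n), coxeq m t (x ++ [:: s] ++ rev x).

Definition refl_prod n (m : 'I_n -> 'I_n -> option nat) (q : nat) (w : word n) : Prop :=
  exists ts : seq (word n),
    size ts = q /\ (forall t, List.In t ts -> is_reflection m t) /\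
    coxeq m w (flatten ts).

Lemma refl_prod_exists n (m : 'I_n -> 'I_n -> option nat) (w : word n) :
  exists q, (fun q => if excluded_middle_informative (refl_prod m q w)
                      then true else false) q.
Proof.
exists (size w).
case: excluded_middle_informative => // H; exfalso; apply: H.
exists [seq [:: s] | s <- w]; split; first by rewrite size_map.
split.
  move=> t /List.in_map_iff [s [<- _]].
  by exists [::], s; apply: rst_refl.
have -> : flatten [seq [:: s] | s <- w] = w by elim: w => //= s w ->.
exact: rst_refl.
Qed.

Definition refl_length n (m : 'I_n -> 'I_n -> option nat) (w : word n) : nat :=
  ex_minn (refl_prod_exists m w).

Definition coxeter_element n (sigma : 'S_n) : word n :=
  [seq sigma i | i <- enum 'I_n].

Definition wpow n (w : word n) (k : nat) : word n := flatten (nseq k w).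

(* lower bound on an entry of the Coxeter matrix, with None = infinity *)
Definition entry_ge (k : nat) (o : option nat) : bool :=
  if o is Some a then k <= a else true.

(* Main.v *)
(** A counting quasimorphism in the style of Brooks bounds the reflection
    length from below.

    Let c be the periodic word s_sigma(1) ... s_sigma(n) s_sigma(1) ..., and let
    p be its prefix of length L = 80. For u in W the translate u p is a path in
    the Cayley graph. A point z is "before" u p if the distance to z grows by L
    along the path, and "after" it if it decreases by L. Let N(x, y) be the
    number of u such that x is before u p and y is after it. Then

    - N(x, y) - N(y, x) is left invariant and antisymmetric, hence vanishes for
      (x, y) = (1, t) with t an involution;
    - it is a quasicocycle with defect at most 6 L: p is rigid (no braid move
      applies to it), so u p behaves like a bridge of a tree. Indeed a point z
      whose distance goes up somewhere along u p keeps going up shortly after,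
      and every geodesic from x to y passes through the middle of u p. So at
      most 2 L of the u counted in N(x, y) have z neither before nor after;
    - N(1, w^k) grows linearly in k, while N(w^k, 1) = 0 because the word c never
      contains p read backwards (n >= 3).

    Since a reflection is an involution, a product of q reflections has
    N(1, g) - N(g, 1) <= 6 L q.

    Rigidity only needs the elements s_i s_j to have order at least 3, plus
    either order at least 4 or four consecutive distinct letters in c. *)
Require Import Defs.
From HB Require Import structures.
From mathcomp Require Import all_boot all_fingroup all_algebra all_field.
From mathcomp Require Import generic_quotient zify ring.
From Stdlib Require Import Relation_Operators ClassicalEpsilon.
Set Implicit Arguments. Unset Strict Implicit. Unset Printing Implicit Defensive.

Local Open Scope group_scope.

(** * The group as a quotient of words *)

Section CoxeterGroup.
Variables (n : nat) (m : 'I_n -> 'I_n -> option nat).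

Lemma coxeq_cat u v u' v' :
  coxeq m u u' -> coxeq m v v' -> coxeq m (u ++ v) (u' ++ v').
Proof.
move=> hu hv; apply: (@rst_trans _ _ _ (u' ++ v)).
- elim: hu => {u u'} [_ _ [a b r hr]|x|x y _|x y z _ h1 _ h2].
  + by rewrite -!catA; apply: rst_step; constructor.
  + exact: rst_refl.
  + exact: rst_sym.
  + exact: rst_trans h1 h2.
- elim: hv => {v v'} [_ _ [a b r hr]|x|x y _|x y z _ h1 _ h2].
  + by rewrite !(catA u'); apply: rst_step; constructor.
  + exact: rst_refl.
  + exact: rst_sym.
  + exact: rst_trans h1 h2.
Qed.

Lemma coxeq_revK u : coxeq m (rev u ++ u) [::].
Proof.
elim: u => [|i u IH]; first exact: rst_refl.
apply: rst_trans IH; rewrite rev_cons -cats1 -catA.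
apply: (@rst_step _ _ (rev u ++ [:: i; i] ++ u)).
by constructor; left; exists i.
Qed.

Definition coxeqb (u v : word n) : bool :=
  if excluded_middle_informative (coxeq m u v) then true else false.

Lemma coxeqP u v : reflect (coxeq m u v) (coxeqb u v).
Proof.
by rewrite /coxeqb; case: excluded_middle_informative => h; constructor.
Qed.

Lemma coxeqb_refl : reflexive coxeqb.
Proof. by move=> u; apply/coxeqP; apply: rst_refl. Qed.

Lemma coxeqb_sym : symmetric coxeqb.
Proof. by move=> u v; apply/coxeqP/coxeqP; apply: rst_sym. Qed.

Lemma coxeqb_trans : transitive coxeqb.
Proof. by move=> v u w /coxeqP h /coxeqP h'; apply/coxeqP; apply: rst_trans h'. Qed.

Canonical coxeq_equiv := EquivRel coxeqb coxeqb_refl coxeqb_sym coxeqb_trans.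

Definition cox := {eq_quot coxeq_equiv}%qT.

HB.instance Definition _ := Choice.on cox.

Definition elt (w : word n) : cox := \pi_({eq_quot coxeq_equiv})%qT w.
Definition eltr (x : cox) : word n := repr (x : {eq_quot coxeq_equiv}%qT).

Lemma eltrK x : elt (eltr x) = x.
Proof. exact: reprK. Qed.

Lemma eltP u v : elt u = elt v <-> coxeq m u v.
Proof.
split=> [/eqP|h]; first by rewrite /elt (eqmodE coxeq_equiv) => /coxeqP.
by apply/eqP; rewrite /elt (eqmodE coxeq_equiv); apply/coxeqP.
Qed.

Definition cox_mul x y := elt (eltr x ++ eltr y).
Definition cox_inv x := elt (rev (eltr x)).

Lemma elt_cox_mul u v : cox_mul (elt u) (elt v) = elt (u ++ v).
Proof. by apply/eltP; apply: coxeq_cat; apply/eltP; rewrite eltrK. Qed.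

Lemma cox_mulA : associative cox_mul.
Proof.
by move=> x y z; rewrite -(eltrK x) -(eltrK y) -(eltrK z) !elt_cox_mul catA.
Qed.

Lemma cox_mul1 : left_id (elt [::]) cox_mul.
Proof. by move=> x; rewrite -(eltrK x) elt_cox_mul. Qed.

Lemma cox_1mul : right_id (elt [::]) cox_mul.
Proof. by move=> x; rewrite -(eltrK x) elt_cox_mul cats0. Qed.

Lemma cox_mulV : left_inverse (elt [::]) cox_inv cox_mul.
Proof.
move=> x; rewrite -{2}(eltrK x) elt_cox_mul; apply/eltP; exact: coxeq_revK.
Qed.

Lemma cox_Vmul : right_inverse (elt [::]) cox_inv cox_mul.
Proof.
move=> x; rewrite -{1}(eltrK x) elt_cox_mul; apply/eltP.
by rewrite -{1}(revK (eltr x)); apply: coxeq_revK.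
Qed.

HB.instance Definition _ := isGroup.Build cox
  cox_mulA cox_mul1 cox_1mul cox_mulV cox_Vmul.

Lemma elt_cat u v : elt (u ++ v) = elt u * elt v.
Proof. by rewrite -elt_cox_mul. Qed.

Definition cgen i : cox := elt [:: i].

Lemma elt_cons i u : elt (i :: u) = cgen i * elt u.
Proof. by rewrite -elt_cat. Qed.

Lemma cgen2 i : cgen i * cgen i = 1.
Proof.
rewrite -elt_cat; apply/eltP; apply: (@rst_step _ _ ([::] ++ [:: i; i] ++ [::])).
by constructor; left; exists i.
Qed.

Lemma cgenV i : (cgen i)^-1 = cgen i.
Proof. by apply/esym/eqP; rewrite -mulg_eq1 cgen2. Qed.

Lemma cgenK i x : cgen i * (cgen i * x) = x.
Proof. by rewrite mulgA cgen2 mul1g. Qed.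

Lemma elt_rev u : elt (rev u) = (elt u)^-1.
Proof.
elim: u => [|i u IH]; first by rewrite invg1.
by rewrite rev_cons -cats1 elt_cat IH (elt_cons i u) invgM cgenV.
Qed.

End CoxeterGroup.

(** * Word length and the exchange condition *)

Section Length.
Variables (n : nat) (m : 'I_n -> 'I_n -> option nat).
Implicit Types (x y z t : cox m) (i j : 'I_n) (w : word n).

Local Notation elt := (elt m).
Local Notation cgen := (cgen m).

Lemma coxeq_invariant (T : Type) (f : word n -> T) :
  (forall u r v, relator m r -> f (u ++ r ++ v) = f (u ++ v)) ->
  forall u v, elt u = elt v -> f u = f v.
Proof.
move=> hf u v /eltP; elim=> {u v} [_ _ [a b r hr]|//|x y _ ->|x y z _ -> _ ->] //.
exact: hf.
Qed.

Lemma odd_size_elt u v : elt u = elt v -> odd (size u) = odd (size v).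
Proof.
apply: (coxeq_invariant (f := fun w => odd (size w))) => {}u r {}v hr.
rewrite !size_cat !oddD; suff -> : odd (size r) = false by [].
case: hr => [[i ->]|[i [j [k [_ [_ ->]]]]]] //.
by rewrite size_flatten /shape map_nseq sumn_nseq oddM.
Qed.

Lemma len_subproof x : exists k, [exists w : k.-tuple 'I_n, elt w == x].
Proof.
by exists (size (eltr x)); apply/existsP; exists (in_tuple (eltr x)); rewrite eltrK.
Qed.

Definition len x : nat := ex_minn (len_subproof x).

Lemma len_elt w : len (elt w) <= size w.
Proof.
rewrite /len; case: ex_minnP => k _; apply.
by apply/existsP; exists (in_tuple w).
Qed.

Lemma len_word x : exists2 w, elt w = x & size w = len x.
Proof.
rewrite /len; case: ex_minnP => k /existsP[w /eqP <-] _.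
by exists w => //; rewrite size_tuple.
Qed.

Lemma len1 : len 1 = 0.
Proof. by apply/eqP; rewrite -leqn0 (len_elt [::]). Qed.

Lemma len_eq0 x : len x = 0 -> x = 1.
Proof. by case: (len_word x) => w <- <- /size0nil ->. Qed.

Lemma len_mul x y : len (x * y) <= len x + len y.
Proof.
case: (len_word x) (len_word y) => u <- <- [v <- <-].
by rewrite -elt_cat -size_cat len_elt.
Qed.

Lemma len_inv x : len x^-1 = len x.
Proof.
have h y : len y^-1 <= len y.
  by case: (len_word y) => u <- <-; rewrite -elt_rev -(size_rev u) len_elt.
by apply/eqP; rewrite eqn_leq h -{1}(invgK x) h.
Qed.

Lemma odd_len w : odd (len (elt w)) = odd (size w).
Proof. by case: (len_word (elt w)) => v /odd_size_elt <- ->. Qed.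

Lemma len_cgen_le i : len (cgen i) <= 1.
Proof. exact: (len_elt [:: i]). Qed.

Lemma len_cgenM i x :
  len (cgen i * x) = (len x).+1 \/ len x = (len (cgen i * x)).+1.
Proof.
have h1 := len_mul (cgen i) x; have h2 := len_mul (cgen i) (cgen i * x).
have h3 := len_cgen_le i; rewrite cgenK in h2.
have: odd (len (cgen i * x)) = ~~ odd (len x).
  by case: (len_word x) => w <- _; rewrite -elt_cons !odd_len.
lia.
Qed.

Lemma len_cgen i : len (cgen i) = 1%N.
Proof. by have := len_cgenM i 1; rewrite mulg1 len1; lia. Qed.

Definition desc i x : bool := len (cgen i * x) < len x.

Lemma descP i x : desc i x -> len x = (len (cgen i * x)).+1.
Proof. by rewrite /desc; have := len_cgenM i x; lia. Qed.

Lemma desc_cgen i x : desc i (cgen i * x) = ~~ desc i x.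
Proof. by rewrite /desc cgenK; have := len_cgenM i x; lia. Qed.

Lemma desc_exists x : x <> 1 -> exists i, desc i x.
Proof.
case: (len_word x) => -[|i w] <- // hs _; exists i.
rewrite /desc -hs elt_cons cgenK /= ltnS; exact: len_elt.
Qed.

(* Parity of the number of letters of [w] whose associated reflection (the
   letter conjugated by the prefix before it) equals [t]. *)
Fixpoint crossings (w : word n) t : bool :=
  if w is i :: w' then (t == cgen i) (+) crossings w' (cgen i * t * cgen i)
  else false.

Lemma crossings_cat u v t :
  crossings (u ++ v) t = crossings u t (+) crossings v ((elt u)^-1 * t * elt u).
Proof.
elim: u t => [|i u IH] t /=; first by rewrite invg1 mul1g mulg1.
by rewrite IH addbA elt_cons invgM cgenV !mulgA.
Qed.

Lemma crossings_dihedral k i j t :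
  crossings (flatten (nseq k [:: i; j])) t =
  \big[addb/false]_(p < k.*2) (t == (cgen i * cgen j) ^+ p * cgen i).
Proof.
elim: k t => [|k IH] t; first by rewrite big_ord0.
rewrite doubleS !big_ord_recl /= -[nseq k _]/(nseq k _) IH.
congr (_ (+) (_ (+) _)).
- by rewrite mul1g.
- rewrite expg1 -(inj_eq (mulgI (cgen i))) -(inj_eq (mulIg (cgen i))).
  by rewrite !mulgA cgen2 mul1g -mulgA -mulgA cgen2 mulg1 mulgA.
apply: eq_bigr => p _; rewrite /bump /= !add1n.
rewrite -(inj_eq (mulgI (cgen i * cgen j))) -(inj_eq (mulIg (cgen j * cgen i))).
congr (_ == _); first by rewrite !mulgA -!(mulgA (cgen i)) -!mulgA !(cgenK, cgen2, mulg1).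
by rewrite !expgSr !mulgA -expgS expgSr -!mulgA.
Qed.

Lemma elt_nseq k i j : elt (flatten (nseq k [:: i; j])) = (cgen i * cgen j) ^+ k.
Proof.
elim: k => [|k IH] //; rewrite expgS -IH.
by rewrite [nseq _ _]/= [flatten _]/= !elt_cons mulgA.
Qed.

Lemma relator_elt r : relator m r -> elt r = 1.
Proof.
move=> hr; apply/eltP/(rst_step _ _ r).
by rewrite -[X in _ X _](cats0 r); apply: (CoxStep [::] [::] hr).
Qed.

Lemma cgen_order i j k : i != j -> m i j = Some k -> (cgen i * cgen j) ^+ k = 1.
Proof.
by move=> hij hk; rewrite -elt_nseq; apply: relator_elt; right; exists i, j, k.
Qed.

(** Along a braid relator with exponent [k] the reflections met are
    [(cgen i * cgen j) ^+ p * cgen i] for [p < k.*2]; the indices [p] and [k + p] give the same one,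
    so every [t] is met an even number of times. *)
Lemma crossings_elt u v t : elt u = elt v -> crossings u t = crossings v t.
Proof.
apply: (coxeq_invariant (f := crossings^~ t)) => {}u r {}v hr.
rewrite !crossings_cat (relator_elt hr) invg1 mul1g mulg1.
congr (_ (+) _); rewrite addbC -[RHS]addbF; congr (_ (+) _).
move: (_ * _ * _) => {}t.
case: hr => [[i ->]|[i [j [k [hij [hk ->]]]]]] /=.
  suff -> : (cgen i * t * cgen i == cgen i) = (t == cgen i) by rewrite addbF addbb.
  rewrite -[in RHS](inj_eq (mulgI (cgen i))) -[in RHS](inj_eq (mulIg (cgen i))).
  by rewrite cgen2 mul1g.
rewrite crossings_dihedral -addnn big_split_ord /=.
under [X in _ (+) X]eq_bigr => p _ do
  rewrite expgnDr (cgen_order hij hk) mul1g.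
by rewrite addbb.
Qed.

Lemma crossings_delete w t : crossings w t ->
  exists w', [/\ subseq w' w, size w = (size w').+1 & t * elt w = elt w'].
Proof.
elim: w t => [|i w IH] t //=.
case: (eqVneq t (cgen i)) => [-> _|_ /IH[w' [sw' hw' ew']]].
  by exists w; split; [exact: subseq_cons | | rewrite elt_cons cgenK].
exists (i :: w'); split; [by rewrite /= eqxx | by rewrite /= hw' |].
by rewrite !elt_cons -ew' -!mulgA cgenK.
Qed.

(** Compare with [i :: r], where [r] is a reduced word of [cgen i * elt w]. Its first letter meets
    [cgen i] once; an odd number of further meetings would delete a letter of [r] and leave a word
    of [elt w] too short for a descent. *)
Lemma desc_crossings w i : desc i (elt w) -> crossings w (cgen i).
Proof.
move=> hd; have [r er sr] := len_word (cgen i * elt w).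
have -> : crossings w (cgen i) = crossings (i :: r) (cgen i).
  by apply: crossings_elt; rewrite elt_cons er cgenK.
rewrite /= eqxx -mulgA cgen2 mulg1; apply/negP => /crossings_delete[r' [_ hr']].
rewrite er cgenK => ew; move: hd (len_elt r').
by rewrite /desc -ew -sr; lia.
Qed.

(** The word is split to locate the deleted letter: later [w1] is an alternating prefix and [w2] the
    rest. *)
Lemma exchange w1 w2 i : desc i (elt (w1 ++ w2)) ->
  (exists w, [/\ subseq w w1, size w1 = (size w).+1 & cgen i * elt w1 = elt w]) \/
  (exists2 w, size w2 = (size w).+1 & cgen i * elt w1 * elt w2 = elt w1 * elt w).
Proof.
move/desc_crossings; rewrite crossings_cat.
case h: (crossings w1 _) => /=; first by move=> _; left; apply: crossings_delete.
move/crossings_delete => [w [_ hw e]]; right; exists w => //.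
by rewrite -e !mulgA mulgV mul1g.
Qed.

(** * Alternating words and elements with two descents *)

Fixpoint alt i j k : cox m := if k is k'.+1 then cgen i * alt j i k' else 1.

Fixpoint altw i j k : word n := if k is k'.+1 then i :: altw j i k' else [::].

Lemma elt_altw i j k : elt (altw i j k) = alt i j k.
Proof. by elim: k i j => //= k IH i j; rewrite elt_cons IH. Qed.

Lemma size_altw i j k : size (altw i j k) = k.
Proof. by elim: k i j => //= k IH i j; rewrite IH. Qed.

Lemma len_alt i j k : len (alt i j k) <= k.
Proof. by rewrite -elt_altw -{2}(size_altw i j k) len_elt. Qed.

Lemma alt_exp i j k : alt i j k = alt j i k -> (cgen i * cgen j) ^+ k = 1.
Proof.
have h p a b : cgen a * (cgen b * cgen a) ^+ p * cgen b = (cgen a * cgen b) ^+ p.+1.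
  elim: p => [|p IH]; first by rewrite mulg1.
  by rewrite [in RHS]expgS -IH [in LHS]expgS !mulgA.
move=> e; suff <- : alt i j k * (alt j i k)^-1 = (cgen i * cgen j) ^+ k.
  by rewrite e mulgV.
elim: k i j {e} => [|k IH] i j; first by rewrite mulgV.
by rewrite /= invgM cgenV -h -IH !mulgA.
Qed.

Lemma mem_altw i j k : all (mem [:: i; j]) (altw i j k).
Proof.
elim: k i j => //= k IH i j; rewrite inE eqxx /=.
by rewrite -(eq_all (a1 := mem [:: j; i])) // => x; rewrite !inE orbC.
Qed.

Lemma reduced_dihedral i j w : all (mem [:: i; j]) w -> size w <= len (elt w) ->
  elt w = alt i j (size w) \/ elt w = alt j i (size w).
Proof.
suff h a w' : all (mem [:: i; j]) (a :: w') ->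
    (size w').+1 <= len (elt (a :: w')) ->
    elt (a :: w') = alt a (if a == i then j else i) (size w').+1.
  case: w => [|a w] hw sw; first by left.
  rewrite (h a w hw sw); move: hw => /= /andP[]; rewrite !inE.
  case: (eqVneq a i) => [->|_ /eqP->] _; first by left.
  by right.
elim: w' a => [|b w' IH] a; first by rewrite elt_cons.
move=> /= /and3P[ha hb hw'].
rewrite elt_cons => hl; have hb' := len_mul (cgen a) (elt (b :: w')).
have ha' := len_cgen a; rewrite IH /= ?hb ?hw' //; last by lia.
have hab : a != b.
  apply/eqP => e; move: hl; rewrite e elt_cons cgenK.
  by have := len_elt w'; lia.
have [eb ea] : (if a == i then j else i) = b /\ (if b == i then j else i) = a.
  move: hab ha hb; rewrite !inE; case: (eqVneq a i) => [->|_] /=.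
    by case: (eqVneq b i) => //= _ _ _ /eqP ->.
  move=> hab /eqP e /orP[/eqP->|/eqP hb2]; first by rewrite eqxx e.
  by rewrite e hb2 eqxx in hab.
by rewrite eb ea.
Qed.

Section Dihedral.
Variable M : nat.
Hypothesis order_ge :
  forall i j k, i != j -> 0 < k -> (cgen i * cgen j) ^+ k = 1 -> M <= k.

Let altpre i j g k := len ((alt i j k)^-1 * g) + k == len g.

(** [altpre i j g k] means that some reduced word of [g] begins with the alternating word. By
    exchange the descent [j] deletes a letter: either from the tail, and then [j] prolongs the
    prefix, or from the prefix, and then the alternating word starting with [j] has the same
    value. *)
Lemma altpre_max i j g k : 0 < k -> altpre i j g k -> ~~ altpre j i g k.+1 ->
  desc j g -> alt i j k = alt j i k.
Proof.
move=> k0 /eqP hk hmax hd.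
have [r er sr] := len_word ((alt i j k)^-1 * g).
have eg : elt (altw i j k ++ r) = g by rewrite elt_cat elt_altw er mulVKg.
have lalt : k <= len (alt i j k).
  by have := len_mul (alt i j k) (elt r); rewrite -elt_altw -elt_cat eg er; lia.
move: (hd); rewrite -eg => /exchange[[w [sw]]|[w sw ew]].
  rewrite elt_altw size_altw => hw ew.
  have ek : alt i j k = cgen j * elt w by rewrite -ew cgenK.
  have := len_mul (cgen j) (elt w); rewrite -ek len_cgen => lw.
  have hall : all (mem [:: i; j]) w.
    by apply/allP => x /(mem_subseq sw); apply/allP/mem_altw.
  case: (reduced_dihedral hall); first by lia.
    by rewrite {1}ek hw => -> /=.
  case: (w) hw ek => [|a w'] /= hw ek e; first by rewrite ek hw.
  by move: lalt; rewrite {1}ek e cgenK; have := len_alt i j (size w'); lia.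
case/negP: hmax; rewrite /altpre /= invgM cgenV -mulgA.
have -> : cgen j * g = alt i j k * elt w.
  by rewrite -eg elt_cat elt_altw mulgA -elt_altw ew.
rewrite mulKg; have := descP hd.
have := len_mul (alt i j k) (elt w); have := len_alt i j k; have := len_elt w.
have -> : alt i j k * elt w = cgen j * g.
  by rewrite -eg elt_cat elt_altw mulgA -elt_altw ew.
by rewrite sr in sw; lia.
Qed.

(** Take the longest alternating prefix of either kind. By maximality both alternating words of that
    length agree, which is a relation of exponent [k] on [cgen i * cgen j]. *)
Lemma dihedral_descents i j g : i != j -> desc i g -> desc j g ->
  exists k g', [/\ M <= k, g = alt i j k * g', alt i j k = alt j i k
                 & len g = k + len g'].
Proof.
move=> hij di dj.
pose P k := altpre i j g k || altpre j i g k.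
have P1 : P 1%N by rewrite /P /altpre /= mulg1 cgenV addn1 -(descP di) eqxx.
have exP : exists k, P k by exists 1%N.
have ubP k : P k -> k <= len g by case/orP => /eqP; lia.
case: (ex_maxnP exP ubP) => k Pk kmax.
have k0 : 0 < k by exact: kmax.
have hmax a : P k.+1 -> a by move/kmax; rewrite ltnn.
have halt : alt i j k = alt j i k.
  case/orP: (Pk) => h.
    by apply: (altpre_max k0 h) => //; apply/negP => h'; apply: hmax; rewrite /P h' orbT.
  by apply/esym/(altpre_max k0 h) => //; apply/negP => h'; apply: hmax; rewrite /P h'.
exists k, ((alt i j k)^-1 * g); split=> //; last 1 first.
- by move: Pk; rewrite /P /altpre -halt orbb => /eqP <-; rewrite addnC.
- exact: order_ge hij k0 (alt_exp halt).
- by rewrite mulVKg.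
Qed.

End Dihedral.
End Length.

(** * The order of a product of two generators *)

Section ProductOrder.
Variables (n : nat) (m : 'I_n -> 'I_n -> option nat).
Hypothesis hm : coxeter_matrix m.
Import GRing.Theory.
Local Open Scope ring_scope.

(* Nothing constrains s_i s_j if m_ij is infinite: any finite order may then be
   chosen for its image, and 5 is large enough here. *)
Definition entry (i j : 'I_n) : nat := if m i j is Some k then k else 5%N.

Lemma entry_ge2 i j : i != j -> (2 <= entry i j)%N.
Proof. by rewrite /entry; case h: (m i j) => [k|] // hij; apply: hm.2 h. Qed.

Definition zeta (k : nat) : algC :=
  if k is k'.+1 then sval (C_prim_root_exists (ltn0Sn k')) else 1.

Lemma zetaP k : (0 < k)%N -> k.-primitive_root (zeta k).
Proof. by case: k => // k _; rewrite /zeta; case: C_prim_root_exists. Qed.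

(* These weights give a (dual) geometric representation over the cyclotomic
   numbers: wt i j * wt j i = 2 + z + z^-1 = 4 cos^2(pi / m_ij) up to conjugacy. *)
Definition wt (i j : 'I_n) : algC :=
  1 + (if (i < j)%N then zeta (entry i j) else (zeta (entry i j))^-1).

Definition act (i : 'I_n) (f : {ffun 'I_n -> algC}) : {ffun 'I_n -> algC} :=
  [ffun u => if u == i then - f i else f u + wt i u * f i].

Lemma actK i f : act i (act i f) = f.
Proof.
apply/ffunP => u; rewrite !ffunE eqxx; case: (eqVneq u i) => [->|hu].
  by rewrite opprK.
by rewrite mulrN addrK.
Qed.

Lemma wt_root i j : i != j -> exists z : algC,
  [/\ forall k, (z ^+ k == 1) = (entry i j %| k)%N, wt i j = 1 + z & wt j i = 1 + z^-1].
Proof.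
move=> hij; have hz := zetaP (ltnW (entry_ge2 hij)).
have -> : wt j i = 1 + (if (j < i)%N then zeta (entry i j) else (zeta (entry i j))^-1).
  by rewrite /wt /entry (hm.1 j i).
rewrite /wt; have : (i < j)%N = ~~ (j < i)%N.
  by move: hij; rewrite -val_eqE /=; lia.
case: (j < i)%N => -> /=.
  exists (zeta (entry i j))^-1; split=> //; last by rewrite invrK.
  by move=> k; rewrite exprVn invr_eq1 (prim_order_dvd hz).
by exists (zeta (entry i j)); split=> // k; rewrite (prim_order_dvd hz).
Qed.

Section Pair.
Variables (s t : 'I_n) (z : algC).
Hypotheses (hst : s != t) (z1 : z != 1) (z0 : z != 0).
Hypotheses (hs : wt s t = 1 + z) (ht : wt t s = 1 + z^-1).
Implicit Types f : {ffun 'I_n -> algC}.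

Let T f := act s (act t f).
(** Linear forms on which [T] acts by [z] and [z^-1]; they are independent because [z != 1]. *)
Let xi f := f s + f t.
Let xi' f := z * f s + f t.

Lemma pairE_s f : T f s = - (f s + (1 + z^-1) * f t).
Proof. by rewrite !ffunE eqxx (negPf hst) ht. Qed.

Lemma pairE_t f : T f t = - f t + (1 + z) * (f s + (1 + z^-1) * f t).
Proof. by rewrite !ffunE eqxx eq_sym (negPf hst) hs ht. Qed.

Lemma pair_xi f : xi (T f) = z * xi f.
Proof. by rewrite /xi pairE_s pairE_t; field. Qed.

Lemma pair_xi' f : xi' (T f) = z^-1 * xi' f.
Proof. by rewrite /xi' pairE_s pairE_t; field. Qed.

Lemma pair_shift u : exists A B, forall f, T f u = f u + A * xi f + B * xi' f.
Proof.
suff [a [b h]] : exists a b, forall f, T f u = f u + a * f s + b * f t.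
  exists ((b * z - a) / (z - 1)), ((a - b) / (z - 1)) => f.
  by rewrite h /xi /xi'; field; rewrite subr_eq0.
case: (eqVneq u s) => [->|us].
  by exists (-2%:R), (- (1 + z^-1)) => f; rewrite pairE_s; ring.
case: (eqVneq u t) => [->|ut].
  exists (1 + z), (-2%:R + (1 + z) * (1 + z^-1)) => f.
  by rewrite pairE_t; ring.
exists (wt s u), (wt t u + wt s u * wt t s) => f.
by rewrite !ffunE (negPf us) (negPf ut) (negPf hst); ring.
Qed.

Lemma pair_iter_xi k f : xi (iter k T f) = z ^+ k * xi f.
Proof. by elim: k => [|k IH]; rewrite ?mul1r //= pair_xi IH exprS mulrA. Qed.

Lemma pair_iter_xi' k f : xi' (iter k T f) = z^-1 ^+ k * xi' f.
Proof. by elim: k => [|k IH]; rewrite ?mul1r //= pair_xi' IH exprS mulrA. Qed.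

(** Each [T] shifts a coordinate by a combination of [xi] and [xi']. The shifts add up to geometric
    sums in [z] and [z^-1], which vanish. *)
Lemma pair_iter_id k f : z ^+ k = 1 -> iter k T f = f.
Proof.
have h (x : algC) : x != 1 -> x ^+ k = 1 -> \sum_(i < k) x ^+ i = 0.
  move=> x1 xk; apply: (mulfI (x := x - 1)); first by rewrite subr_eq0.
  by rewrite -subrX1 xk subrr mulr0.
move=> zk; apply/ffunP => u; have [A [B hAB]] := pair_shift u.
suff -> : iter k T f u = f u + A * (\sum_(i < k) z ^+ i) * xi f
                             + B * (\sum_(i < k) z^-1 ^+ i) * xi' f.
  rewrite !h ?exprVn ?zk ?invr1 ?mulr0 ?mul0r ?addr0 //.
  by rewrite -(inj_eq invr_inj) invrK invr1.
elim: (k) => [|j IH]; first by rewrite !big_ord0 !mulr0 !mul0r !addr0.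
by rewrite iterS hAB pair_iter_xi pair_iter_xi' IH !big_ord_recr /=; ring.
Qed.

(** The indicator of [s] has [xi] equal to 1, so [xi] records the power of [z] along its orbit. *)
Lemma pair_iter_fixed k : iter k T [ffun u => (u == s)%:R] = [ffun u => (u == s)%:R] ->
  z ^+ k = 1.
Proof.
move=> e; have := pair_iter_xi k [ffun u => (u == s)%:R].
by rewrite e /xi !ffunE eqxx eq_sym (negPf hst) addr0 mulr1.
Qed.

End Pair.

Definition actw (w : word n) f := foldr act f w.

Lemma actw_nseq k i j f :
  actw (flatten (nseq k [:: i; j])) f = iter k (fun f => act i (act j f)) f.
Proof. by elim: k => //= k ->. Qed.

Lemma actw_elt u v f : elt m u = elt m v -> actw u f = actw v f.
Proof.
apply: (coxeq_invariant (f := actw^~ f)) => {}u r {}v hr.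
rewrite /actw !foldr_cat -!/(actw _ _); congr actw; move: (actw v f) => g.
case: hr => [[i ->]|[i [j [k [hij [hk ->]]]]]]; first exact: actK.
have [z [hz hs ht]] := wt_root hij; rewrite actw_nseq.
have ek : entry i j = k by rewrite /entry hk.
have k2 := hm.2 _ _ _ hij hk; rewrite ek in hz.
apply: (pair_iter_id hij _ _ hs ht); last by apply/eqP; rewrite hz.
- by rewrite -(expr1 z) hz; apply/negP => /dvdn_leq; lia.
- apply/eqP => z0; have := hz k; rewrite z0 dvdnn expr0n.
  by case: (k) k2 => // k' _; rewrite eq_sym oner_eq0.
Qed.

Lemma cgen_mul_order i j k : i != j ->
  ((cgen m i * cgen m j) ^+ k = 1)%g -> (entry i j %| k)%N.
Proof.
move=> hij; rewrite -elt_nseq => e; have [z [hz hs ht]] := wt_root hij.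
rewrite -hz; apply/eqP.
have k2 := entry_ge2 hij.
apply: (pair_iter_fixed hij _ hs ht).
  by apply/eqP => z0; have := hz (entry i j);
    rewrite z0 dvdnn expr0n; case: (entry i j) k2 => // k' _; rewrite eq_sym oner_eq0.
by rewrite -actw_nseq (actw_elt _ e).
Qed.

End ProductOrder.

(** * Pairs of descents, and going up along a rigid word *)

Section Descents.
Variables (n : nat) (m : 'I_n -> 'I_n -> option nat) (M : nat).
Hypothesis M3 : 3 <= M.
Hypothesis order_ge : forall i j k,
  i != j -> 0 < k -> (cgen m i * cgen m j) ^+ k = 1 -> M <= k.
Implicit Types (x y z g q : cox m).

Local Notation cgen := (cgen m).

Lemma alt_add i j p r :
  alt m i j (p + r) = alt m i j p * (if odd p then alt m j i r else alt m i j r).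
Proof.
elim: p i j => [|p IH] i j; first by rewrite mul1g.
by rewrite /= IH mulgA; case: (odd p).
Qed.

Lemma altSr i j p :
  alt m i j p.+1 = alt m i j p * cgen (if odd p then j else i).
Proof. by rewrite -addn1 alt_add; case: (odd p); rewrite /= mulg1. Qed.

(** The [k] letters peeled off begin a reduced word of [g], so each removal lowers the length by
    exactly one. *)
Lemma dihedral_desc i j g : i != j -> desc i g -> desc j g ->
  exists k, [/\ M <= k, alt m i j k = alt m j i k &
    forall p, p < k -> desc (if odd p then j else i) ((alt m i j p)^-1 * g)].
Proof.
move=> hij di dj; have [k [g' [Mk eg halt lg]]] := dihedral_descents order_ge hij di dj.
exists k; split=> // p pk.
have hlen r : r <= k -> len ((alt m i j r)^-1 * g) + r = len g.
  move=> rk; pose b := if odd r then alt m j i (k - r) else alt m i j (k - r).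
  have eb : (alt m i j r)^-1 * g = b * g'.
    by rewrite eg -{1}[k](subnKC rk) alt_add -mulgA mulKg.
  have lb : len b <= k - r by rewrite /b; case: (odd r); apply: len_alt.
  have := len_mul (alt m i j r) ((alt m i j r)^-1 * g).
  by rewrite mulVKg eb; have := len_alt m i j r; have := len_mul b g'; lia.
have := hlen p (ltnW pk); have := hlen p.+1 pk.
have -> : (alt m i j p.+1)^-1 * g =
    cgen (if odd p then j else i) * ((alt m i j p)^-1 * g).
  by rewrite altSr invgM cgenV mulgA.
by rewrite /desc; lia.
Qed.

Lemma desc2 i j g : i != j -> desc i g -> desc j g ->
  [/\ desc j (cgen i * g), desc i (cgen j * (cgen i * g)) &
      4 <= M -> desc j (cgen i * (cgen j * (cgen i * g)))].
Proof.
move=> hij di dj; have [k [Mk _ h]] := dihedral_desc hij di dj.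
split=> [||M4].
- by have := h 1%N; rewrite /= mulg1 cgenV; apply; lia.
- by have := h 2; rewrite /= !invgM invg1 !cgenV mul1g -!mulgA; apply; lia.
- by have := h 3; rewrite /= !invgM invg1 !cgenV mul1g -!mulgA; apply; lia.
Qed.

(* Infinite descent: a counterexample [g; i, j, u] yields [cgen i * g; j, u, i]. *)
Lemma desc_after i j u g :
  i != j -> desc i g -> desc j g -> desc u (cgen i * g) -> u = j.
Proof.
have [l] := ubnP (len g); elim: l => // l IH in i j u g *.
move=> lg hij di dj du; apply/eqP/negP => /negP huj.
have hiu : i != u by apply/eqP => e; move: du; rewrite -e desc_cgen di.
have [dj' di' _] := desc2 hij di dj.
suff e : i = u by rewrite e eqxx in hiu.
by apply: IH dj' du di'; rewrite 1?eq_sym //; move: di lg; rewrite /desc; lia.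
Qed.

(* For M = 3 consecutive letters i j k i must be excluded as well: along them the
   distance to a point may go up, down, up and down again. *)
Definition rigid (L : nat) (c : nat -> 'I_n) : Prop :=
  [/\ forall i, i.+1 < L -> c i != c i.+1,
      forall i, i.+2 < L -> c i != c i.+2 &
      4 <= M \/ forall i, i.+3 < L -> c i != c i.+3].

Section Sequence.
Variables (L : nat) (c : nat -> 'I_n) (g : nat -> cox m).
Hypothesis hc : rigid L c.
Hypothesis hg : forall i, i < L -> g i.+1 = cgen (c i) * g i.

Let up i := ~~ desc (c i) (g i).

Lemma up_desc i : i < L -> up i = desc (c i) (g i.+1).
Proof. by move=> iL; rewrite hg // desc_cgen. Qed.

Lemma seq_back i : i < L -> cgen (c i) * g i.+1 = g i.
Proof. by move=> iL; rewrite hg // cgenK. Qed.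

Lemma up_up i : i.+2 < L -> up i -> up i.+1 -> up i.+2.
Proof.
case: hc => h1 h2 _ iL; rewrite up_desc 1?up_desc; try lia.
move=> ui ui1; apply/negP => d2; have : c i = c i.+2.
  apply: (desc_after (i := c i.+1)) ui1 d2 _; first by apply: h1; lia.
  by rewrite seq_back //; lia.
by apply/eqP; apply: h2.
Qed.

Lemma up_down_desc i u : i.+1 < L -> up i -> ~~ up i.+1 -> desc u (g i.+2) -> u = c i.
Proof.
case: hc => h1 _ _ iL; rewrite up_desc; last by lia.
rewrite negbK => ui di1; rewrite hg //; apply: (desc_after _ di1 ui).
by rewrite eq_sym; apply: h1.
Qed.

Lemma up_down_up i : i.+2 < L -> up i -> ~~ up i.+1 -> up i.+2.
Proof.
case: hc => _ h2 _ iL ui di; apply/negP => /(up_down_desc (ltnW iL) ui di) /esym/eqP.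
by apply/negP; apply: h2.
Qed.

(** Up, down, up, down would give pairs of descents at [g i.+1] and at [g i.+3], and [desc_after]
    forces [c i = c i.+3]. If [4 <= M], the two dihedral segments both yield descents at
    [cgen (c i) * g i.+2], and [desc_after] forces [c i = c i.+2]. *)
Lemma up_down_up2 i : i.+3 < L -> up i -> ~~ up i.+1 -> up i.+3.
Proof.
move=> iL ui di; have := up_down_up (ltnW iL) ui di.
case: hc => h1 h2 h3; rewrite up_desc //; last by lia.
move: ui di; rewrite up_desc ?negbK; last by lia.
move=> ui di u2; apply/negP => d3.
have hi1 : c i.+1 != c i by rewrite eq_sym; apply: h1; lia.
have [di2 dd d4] := desc2 hi1 di ui.
rewrite -!hg in di2 dd d4; try (clear -iL; lia).
have h23 : c i.+2 != c i.+3 by apply: h1; (clear -iL; lia).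
have e : c i = c i.+3.
  by apply: (desc_after h23 u2 d3); rewrite seq_back //; (clear -iL; lia).
case: h3 => [M4|h3]; last by move/eqP: e; apply/negP; apply: h3.
rewrite -e in d3 h23.
have [_ dh _] := desc2 h23 u2 d3; rewrite seq_back in dh; last by (clear -iL; lia).
have h12 : c i.+1 != c i.+2 by apply: h1; (clear -iL; lia).
have := desc_after h12 dd dh (d4 M4).
by apply/eqP; apply: h2; (clear -iL; lia).
Qed.

(** Two consecutive ups propagate, and an up followed by a down is followed by two ups. Only the
    step right after [i] can thus be an exception. *)
Lemma up_persists i j : up i -> i.+2 <= j -> j < L -> up j.
Proof.
have huu a : up a -> up a.+1 -> forall b, a <= b -> b < L -> up b.
  move=> ua ua1; suff h b : a + b.+1 < L -> up (a + b) && up (a + b.+1).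
    move=> b ab bL; case: (ltnP a b) => [lt|?]; last by have -> : b = a by lia.
    have /andP[_] := h (b - a).-1 ltac:(lia).
    by have -> : a + (b - a).-1.+1 = b by lia.
  elim: b => [|b IH]; first by rewrite addn0 addn1 ua ua1.
  move=> bL; have /andP[u1 u2] := IH ltac:(lia); rewrite u2 /=.
  by rewrite !addnS in bL u2 *; apply: up_up; rewrite ?bL.
move=> ui ij jL; case u1 : (up i.+1); first by apply: huu u1 _ _ _; lia.
have u2 : up i.+2 by apply: up_down_up; rewrite ?u1 //; lia.
case: (ltnP i.+2 j) => [lt|?]; last by have -> : j = i.+2 by lia.
apply: (huu i.+2) => //; try lia.
by apply: up_down_up2; rewrite ?u1 //; lia.
Qed.

(** The margin 6 is two steps for [up_persists] plus four ups ending at [j]. A second descent [s] at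
    [g j] must be [c k.+2] by [desc_after]; its dihedral segment then contradicts the rigidity of
    the four letters. *)
Lemma up_desc_eq i j s : up i -> i + 6 <= j -> j <= L -> desc s (g j) -> s = c j.-1.
Proof.
move=> ui ij jL.
have upk a : i.+2 <= a -> a < L -> desc (c a) (g a.+1).
  by move=> ia aL; rewrite -up_desc //; apply: up_persists ui ia aL.
case: hc => h1 h2 h3.
have [k ek] : exists k, j = k.+4 by exists (j - 4); lia.
have {upk} [u0 u1 u2 u3] : [/\ desc (c k) (g k.+1), desc (c k.+1) (g k.+2),
    desc (c k.+2) (g k.+3) & desc (c k.+3) (g k.+4)].
  by split; apply: upk; clear -ij jL ek; lia.
rewrite ek /= => ds; apply/eqP/negP => /negP hs; rewrite eq_sym in hs.
have b3 := seq_back (i := k.+3) ltac:(clear -ij jL ek; lia).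
have b2 := seq_back (i := k.+2) ltac:(clear -ij jL ek; lia).
have b1 := seq_back (i := k.+1) ltac:(clear -ij jL ek; lia).
have es : c k.+2 = s by apply: (desc_after hs u3 ds); rewrite b3.
rewrite -es in ds hs; have [_ d2 d3] := desc2 hs u3 ds; rewrite b3 b2 in d2 d3.
have h13 : c k.+1 != c k.+3 by apply: h2; clear -ij jL ek; lia.
case: h3 => [M4|h3].
  rewrite eq_sym in h13; have := desc_after h13 d2 u1 (d3 M4).
  by move/esym/eqP; apply/negP; apply: h1; clear -ij jL ek; lia.
have : c k = c k.+3 by apply: (desc_after h13 u1 d2); rewrite b1.
by apply/eqP; apply: h3; clear -ij jL ek; lia.
Qed.

End Sequence.
End Descents.

(** * Distance in the Cayley graph along a path *)

Section Distance.
Variables (n : nat) (m : 'I_n -> 'I_n -> option nat).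
Implicit Types (x y z q u : cox m) (s : 'I_n) (v : nat -> cox m) (c : nat -> 'I_n).

Local Notation cgen := (cgen m).

Definition dist x y : nat := len (x^-1 * y).

Lemma distxx x : dist x x = 0.
Proof. by rewrite /dist mulVg len1. Qed.

Lemma distC x y : dist x y = dist y x.
Proof. by rewrite /dist -len_inv invgM invgK. Qed.

Lemma dist_tri q x y : dist x y <= dist x q + dist q y.
Proof.
have e : x^-1 * y = (x^-1 * q) * (q^-1 * y) by rewrite mulgA mulgK.
by rewrite /dist e; apply: len_mul.
Qed.

Lemma dist0 x y : dist x y = 0 -> x = y.
Proof. by move/len_eq0/eqP; rewrite mulg_eq1 => /eqP/invg_inj. Qed.

Lemma dist_mul u x y : dist (u * x) (u * y) = dist x y.
Proof.
have e : (u * x)^-1 * (u * y) = x^-1 * y by rewrite invgM -mulgA mulKg.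
by rewrite /dist e.
Qed.

Lemma dist1 x : dist 1 x = len x.
Proof. by rewrite /dist invg1 mul1g. Qed.

Lemma dist_cgen s x y :
  dist (x * cgen s) y = len (cgen s * (x^-1 * y)).
Proof.
have e : (x * cgen s)^-1 * y = cgen s * (x^-1 * y) by rewrite invgM cgenV mulgA.
by rewrite /dist e.
Qed.

Lemma desc_dist s x y : desc s (x^-1 * y) = (dist (x * cgen s) y < dist x y).
Proof. by rewrite dist_cgen. Qed.

Lemma dist_step s x y :
  dist (x * cgen s) y = (dist x y).+1 \/ dist x y = (dist (x * cgen s) y).+1.
Proof. by rewrite dist_cgen; apply: len_cgenM. Qed.

Definition path_along L v c := forall k, k < L -> v k.+1 = v k * cgen (c k).

Definition up v z k : bool := dist (v k) z < dist (v k.+1) z.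

Section Along.
Variables (L : nat) (v : nat -> cox m) (c : nat -> 'I_n).
Hypothesis hv : path_along L v c.

Lemma along_step k z : k < L ->
  dist (v k.+1) z = (dist (v k) z).+1 \/ dist (v k) z = (dist (v k.+1) z).+1.
Proof. by move=> kL; rewrite hv //; apply: dist_step. Qed.

Lemma up_desc_along k z : k < L -> up v z k = ~~ desc (c k) ((v k)^-1 * z).
Proof.
move=> kL; rewrite desc_dist -hv // /up.
by have := along_step z kL; lia.
Qed.

Lemma up_start : 0 < L -> up v (v 0) 0.
Proof. by move=> L0; have := along_step (v 0) L0; rewrite /up distxx; lia. Qed.

Lemma along_lip j k z : j <= k -> k <= L -> dist (v k) z <= dist (v j) z + (k - j).
Proof.
move=> jk; rewrite -(subnKC jk); elim: (k - j) => [|p IH] pL; first by rewrite addn0; lia.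
have hp : j + p < L by lia.
have := along_step z hp; have := IH (ltnW hp).
by rewrite addnS; lia.
Qed.

Lemma along_lip' j k z : j <= k -> k <= L -> dist (v j) z <= dist (v k) z + (k - j).
Proof.
move=> jk; rewrite -(subnKC jk); elim: (k - j) => [|p IH] pL; first by rewrite addn0; lia.
have hp : j + p < L by lia.
have := along_step z hp; have := IH (ltnW hp).
by rewrite addnS; lia.
Qed.

Lemma all_down y j : dist (v 0) y = L + dist (v L) y -> j <= L ->
  dist (v j) y = (L - j) + dist (v L) y.
Proof.
move=> hy jL; have := along_lip' y (leq0n j) jL.
by have := along_lip' y jL (leqnn L); lia.
Qed.

Lemma all_up x j : dist x (v L) = dist x (v 0) + L -> j <= L ->
  dist x (v j) = dist x (v 0) + j.
Proof.
rewrite !(distC x) => hy jL; have := along_lip x (leq0n j) jL.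
by have := along_lip x jL (leqnn L); lia.
Qed.

Lemma along_dist j k : j <= k -> k <= L -> dist (v j) (v k) <= k - j.
Proof.
by move=> jk kL; have := along_lip (v j) jk kL; rewrite distxx distC; lia.
Qed.

Lemma along_rev : path_along L (fun k => v (L - k)) (fun k => c (L - k.+1)).
Proof.
move=> k kL /=; have -> : L - k = (L - k.+1).+1 by lia.
by rewrite hv -?mulgA ?cgen2 ?mulg1 //; lia.
Qed.

Lemma along_shift i : path_along (L - i) (fun k => v (i + k)) (fun k => c (i + k)).
Proof. by move=> k kL /=; rewrite addnS hv //; lia. Qed.

Lemma along_widen k : k <= L -> path_along k v c.
Proof. by move=> kL j jk; apply: hv; lia. Qed.

Lemma up_rev z k : k < L -> up (fun k => v (L - k)) z k = ~~ up v z (L - k.+1).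
Proof.
move=> kL; rewrite /up; have h : L - k.+1 < L by lia.
have := along_step z h; have -> : (L - k.+1).+1 = L - k by lia.
lia.
Qed.

End Along.

Lemma rigid_rev M L c : rigid M L c -> rigid M L (fun k => c (L - k.+1)).
Proof.
case=> h1 h2 h3; split=> [i iL|i iL|]; last first.
  case: h3 => [M4|h3]; [by left | right=> i iL].
  have -> : L - i.+1 = (L - i.+4).+3 by lia.
  by rewrite eq_sym; apply: h3; lia.
all: rewrite eq_sym.
- have -> : L - i.+1 = (L - i.+3).+2 by lia.
  by apply: h2; lia.
- have -> : L - i.+1 = (L - i.+2).+1 by lia.
  by apply: h1; lia.
Qed.

Lemma rigid_shift M L c i : rigid M L c -> rigid M (L - i) (fun k => c (i + k)).
Proof.
case=> h1 h2 h3; split=> [k kL|k kL|]; rewrite ?addnS.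
- by apply: h1; lia.
- by apply: h2; lia.
case: h3 => [M4|h3]; [by left | right=> k kL; rewrite !addnS; apply: h3; lia].
Qed.

Lemma rigid_widen M L c k : k <= L -> rigid M L c -> rigid M k c.
Proof.
move=> kL [h1 h2 h3]; split=> [i ik|i ik|]; [apply: h1; lia|apply: h2; lia|].
by case: h3 => [M4|h3]; [left | right=> i ik; apply: h3; lia].
Qed.

Section RigidPath.
Variable M : nat.
Hypothesis M3 : 3 <= M.
Hypothesis order_ge : forall i j k,
  i != j -> 0 < k -> (cgen i * cgen j) ^+ k = 1 -> M <= k.

Section OnePath.
Variables (L : nat) (v : nat -> cox m) (c : nat -> 'I_n).
Hypothesis hc : rigid M L c.
Hypothesis hv : path_along L v c.

Lemma seq_along z k : k < L -> (v k.+1)^-1 * z = cgen (c k) * ((v k)^-1 * z).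
Proof. by move=> kL; rewrite hv // invgM cgenV mulgA. Qed.

Lemma up_mono z i j : up v z i -> i.+2 <= j -> j < L -> up v z j.
Proof.
move=> ui ij jL; rewrite (up_desc_along hv) //; move: ui.
rewrite (up_desc_along hv); last by lia.
move=> ui.
exact: (up_persists M3 order_ge hc (g := fun k => (v k)^-1 * z) (@seq_along z) ui ij jL).
Qed.

Lemma up_desc_last z i j s : up v z i -> i + 6 <= j -> j <= L ->
  desc s ((v j)^-1 * z) -> s = c j.-1.
Proof.
move=> ui ij jL ds; move: ui; rewrite (up_desc_along hv); last by lia.
move=> ui; exact: (up_desc_eq M3 order_ge hc (g := fun k => (v k)^-1 * z)
  (@seq_along z) ui ij jL ds).
Qed.

Lemma up_dist z i j k : up v z i -> i.+2 <= j -> j <= k -> k <= L ->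
  dist (v k) z = dist (v j) z + (k - j).
Proof.
move=> ui ij jk; rewrite -(subnKC jk).
elim: (k - j) => [|p IH] pL; first by rewrite addn0; lia.
have hp : j + p < L by lia.
have := IH (ltnW hp).
have := up_mono ui (j := j + p) ltac:(clear -ij; lia) hp; rewrite /up.
by have := along_step hv z hp; rewrite addnS; lia.
Qed.

End OnePath.

Section OnePathDown.
Variables (L : nat) (v : nat -> cox m) (c : nat -> 'I_n).
Hypothesis hc : rigid M L c.
Hypothesis hv : path_along L v c.

Lemma down_dist z i j k : ~~ up v z i -> i < L -> j <= k -> k < i ->
  dist (v j) z = dist (v k) z + (k - j).
Proof.
move=> ui iL jk ki.
have := up_dist (rigid_rev hc) (along_rev hv) (z := z) (i := L - i.+1)
  (j := L - k) (k := L - j).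
rewrite (up_rev hv); last by lia.
have -> : L - (L - i.+1).+1 = i by lia.
have -> : L - (L - j) = j by lia.
have -> : L - (L - k) = k by lia.
have -> : L - j - (L - k) = k - j by lia.
by apply=> //; clear -iL ki jk; lia.
Qed.

Lemma down_desc_first z i j s : ~~ up v z i -> i < L -> j + 5 <= i ->
  desc s ((v j)^-1 * z) -> s = c j.
Proof.
move=> ui iL ji ds.
have := up_desc_last (rigid_rev hc) (along_rev hv) (z := z) (i := L - i.+1)
  (j := L - j) (s := s).
rewrite (up_rev hv); last by lia.
have -> : L - (L - i.+1).+1 = i by lia.
have -> : L - (L - j) = j by lia.
have -> : L - (L - j).-1.+1 = j by lia.
by apply=> //; clear -iL ji; lia.
Qed.

End OnePathDown.
End RigidPath.
End Distance.

(** * Geodesics that run along a rigid path *)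

Section Contraction.
Variables (n : nat) (m : 'I_n -> 'I_n -> option nat) (M : nat).
Hypothesis M3 : 3 <= M.
Hypothesis order_ge : forall i j k,
  i != j -> 0 < k -> (cgen m i * cgen m j) ^+ k = 1 -> M <= k.
Implicit Types (x y z q u : cox m) (s : 'I_n) (v : nat -> cox m) (c : nat -> 'I_n).

Local Notation cgen := (cgen m).

Lemma geod_pred o q y s : dist o y = dist o q + dist q y -> desc s (q^-1 * o) ->
  (dist o (q * cgen s)).+1 = dist o q /\
  dist o y = dist o (q * cgen s) + dist (q * cgen s) y.
Proof.
move=> hq; rewrite desc_dist => ds.
have h1 := dist_step s q o; have h2 := dist_step s q y.
have h3 := dist_tri (q * cgen s) o y.
rewrite !(distC o) in hq h3 *; lia.
Qed.

Section OnePath.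
Variables (L : nat) (v : nat -> cox m) (c : nat -> 'I_n).
Hypothesis hc : rigid M L c.
Hypothesis hv : path_along L v c.

(** By induction the predecessor of [q] towards [v 0] is [v N], and the geodesic leaves [v N] by a
    descent towards [y]. The path descends towards [y] throughout, so with enough letters left that
    descent can only be [c N]. *)
Lemma geod_prefix y q : dist (v 0) y = L + dist (v L) y ->
  dist (v 0) y = dist (v 0) q + dist q y -> dist (v 0) q + 5 <= L ->
  q = v (dist (v 0) q).
Proof.
move=> hy; move e: (dist (v 0) q) => N; elim: N q e => [|N IH] q e hq NL.
  by apply/esym/dist0.
have hq1 : q^-1 * v 0 <> 1.
  by move=> h; move: e; rewrite distC /dist h len1.
have [s ds] := desc_exists hq1; rewrite -e in hq.
have [e' hq'] := geod_pred hq ds.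
have eN : dist (v 0) (q * cgen s) = N by lia.
have ev := IH _ eN ltac:(by rewrite -eN) ltac:(by clear -NL; lia).
have hs : s = c N.
  have hd : ~~ up v y L.-1.
    rewrite /up prednK; last by clear -NL; lia.
    by rewrite (all_down hv hy (leq_pred L)); lia.
  apply: (down_desc_first M3 order_ge hc hv hd); try by clear -NL; lia.
  rewrite desc_dist -ev -mulgA cgen2 mulg1; lia.
by rewrite hv -?ev -?hs -?mulgA ?cgen2 ?mulg1 //; clear -NL; lia.
Qed.

Lemma up_descE z j s : up v z 0 -> 6 <= j -> j <= L ->
  desc s ((v j)^-1 * z) = (s == c j.-1).
Proof.
move=> u0 j6 jL; apply/idP/eqP => [ds|->].
  exact: (up_desc_last M3 order_ge hc hv u0 j6 jL ds).
case: j j6 jL => // j j6 jL.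
have := up_mono M3 order_ge hc hv u0 (j := j) ltac:(lia) ltac:(lia).
by rewrite desc_dist {1}hv // -mulgA cgen2 mulg1.
Qed.

(* Seen from a point [q] of a geodesic from [v 0] to [y] the points [v 0] and
   [z] are in the same direction: two distinct descents towards [z] would
   span a long dihedral segment, which the rigid path does not contain. *)
Lemma project_ind z y q : 16 <= L -> up v z 0 -> dist (v 0) y = L + dist (v L) y ->
  dist (v 0) y = dist (v 0) q + dist q y -> 6 <= dist (v 0) q ->
  (forall s, desc s (q^-1 * v 0) = desc s (q^-1 * z)) /\
  dist q z + 6 = dist (v 6) z + dist (v 0) q.
Proof.
move=> L16 u0 hy.
have [N] := ubnP (dist (v 0) q); elim: N q => // N IH q qN hq q6.
have u00 : up v (v 0) 0 by apply: (up_start hv); lia.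
(* Up to distance 9 the point [q] lies on the path, where the last letter is the only descent
   towards [v 0] and towards [z]. *)
case: (leqP (dist (v 0) q) 9) => q9.
  have eq : q = v (dist (v 0) q) by apply: (geod_prefix hy hq); lia.
  move: q6 q9; set d := dist _ q in eq *; rewrite eq => q6 q9; split.
    by move=> s; rewrite !up_descE //; lia.
  by rewrite (up_dist M3 order_ge hc hv u0 (j := 6) _ q6); lia.
have IH' s : desc s (q^-1 * v 0) ->
    (forall r, desc r ((q * cgen s)^-1 * v 0) = desc r ((q * cgen s)^-1 * z)) /\
    dist (q * cgen s) z + 6 = dist (v 6) z + dist (v 0) (q * cgen s).
  move=> ds; have [e1 e2] := geod_pred hq ds.
  by apply: IH => //; clear -e1 qN q9; lia.
have fwd s : desc s (q^-1 * v 0) -> dist q z = (dist (q * cgen s) z).+1.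
  move=> ds; have [/(_ s) hs _] := IH' s ds.
  have e : q * cgen s * cgen s = q by rewrite -mulgA cgen2 mulg1.
  move: ds hs; rewrite !desc_dist e => ds.
  have := dist_step s q z; lia.
have hq1 : q^-1 * v 0 <> 1.
  by move=> h; move: q9; rewrite distC /dist h len1.
have [s ds] := desc_exists hq1.
split; last first.
  have [_] := IH' s ds; have := fwd s ds; have [] := geod_pred hq ds.
  by clear; lia.
have dsz t : desc t (q^-1 * v 0) -> desc t (q^-1 * z).
  by move=> /fwd; rewrite desc_dist => ->.
move=> r; apply/idP/idP; first exact: dsz.
move=> dr; apply/negPn/negP => ndr.
have hsr : s != r by apply/eqP => e; move: ndr; rewrite -e ds.
have [k [Mk halt hk]] := dihedral_desc M3 order_ge hsr (dsz s ds) dr.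
pose qq p := q * alt m s r p; pose lt p := if odd p then r else s.
have qqS p : qq p.+1 = qq p * cgen (lt p) by rewrite /qq altSr mulgA.
have qqz p : p < k -> desc (lt p) ((qq p)^-1 * z).
  by move=> pk; have := hk p pk; rewrite /qq invgM mulgA.
have qq0 : qq 0 = q by rewrite /qq mulg1.
(* The dihedral segment spanned by [s] and [r] towards [z] also leads towards [v 0]: below [q], the
   descents towards both agree by induction. *)
have main p : p <= k -> p + 6 <= dist (v 0) q ->
    [/\ dist (v 0) (qq p) + p = dist (v 0) q,
        dist (v 0) y = dist (v 0) (qq p) + dist (qq p) y &
        p < k -> desc (lt p) ((qq p)^-1 * v 0)].
  elim: p => [|p IHp] pk p6; first by rewrite qq0 addn0.
  have [e1 e2 /(_ pk) e3] := IHp (ltnW pk) ltac:(by clear -p6; lia).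
  have [e4 e5] := geod_pred e2 e3; rewrite -qqS in e4 e5; split=> //.
    by clear -e1 e4; lia.
  have hN : dist (v 0) (qq p.+1) < N by clear -e1 e4 p6 qN; lia.
  have h6 : 6 <= dist (v 0) (qq p.+1) by clear -e1 e4 p6 qN; lia.
  by move=> pk'; have [h _] := IH _ hN e5 h6; rewrite h; apply: qqz.
(* If the whole segment fits, it can also be started with [r], which is then a descent towards
   [v 0]. *)
case: (leqP (k + 6) (dist (v 0) q)) => hkN.
  have [e1 _ _] := main k (leqnn k) hkN.
  have k0 : k = k.-1.+1 by clear -Mk M3; lia.
  have e : qq k = (q * cgen r) * alt m s r k.-1.
    by rewrite /qq halt k0 /= mulgA.
  have e2 : dist (v 0) (q * cgen r) <= dist (v 0) (qq k) + k.-1.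
    have := dist_tri (qq k) (v 0) (q * cgen r).
    suff : dist (qq k) (q * cgen r) <= k.-1 by clear; lia.
    rewrite e -{2}(mulg1 (q * cgen r)) dist_mul distC dist1; exact: len_alt.
  move: ndr; rewrite desc_dist !(distC _ (v 0)).
  by move: e1 e2 k0; clear; lia.
(* Otherwise the segment runs into the path: at distances 9 and 7 from [v 0] it continues by [c 8]
   and [c 6], equal by alternation but distinct by rigidity. *)
pose p := dist (v 0) q - 9.
have at_v a : p <= a -> a + 7 <= dist (v 0) q -> lt a = c (dist (v 0) q - a).-1.
  move=> pa aN; have [|| e1 e2 e3] := main a; try by move: hkN aN; clear; lia.
  have e4 : dist (v 0) (qq a) = dist (v 0) q - a by move: e1; clear; lia.
  have eq : qq a = v (dist (v 0) q - a).
    by rewrite -e4; apply: (geod_prefix hy e2); move: e4 pa L16; rewrite /p; clear; lia.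
  have := e3 ltac:(by move: hkN aN; clear; lia).
  rewrite eq up_descE //; [by move/eqP | | ]; move: pa aN L16; rewrite /p; clear; lia.
have := at_v p (leqnn p) ltac:(by rewrite /p; clear -q9; lia).
rewrite /lt.
have -> : odd p = odd p.+2 by rewrite /= negbK.
have := at_v p.+2 ltac:(by clear; lia) ltac:(by rewrite /p; clear -q9; lia).
rewrite /lt => ->.
have -> : (dist (v 0) q - p).-1 = 8 by rewrite /p; clear -q9; lia.
have -> : (dist (v 0) q - p.+2).-1 = 6 by rewrite /p; clear -q9; lia.
case: hc => _ h2 _; apply/eqP/h2; clear -L16; lia.
Qed.

End OnePath.
End Contraction.

(** * Separation of points by a rigid path *)

Section HalfSpaces.
Variables (n : nat) (m : 'I_n -> 'I_n -> option nat).
Implicit Types (x y z q u : cox m) (s : 'I_n) (v : nat -> cox m) (c : nat -> 'I_n).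

Local Notation cgen := (cgen m).

Definition before L v x : bool := dist x (v L) == dist x (v 0) + L.
Definition after L v y : bool := dist (v 0) y == L + dist (v L) y.

Lemma before_rev L v x : before L (fun k => v (L - k)) x = after L v x.
Proof. by rewrite /before /after subnn subn0 !(distC x) addnC. Qed.

Lemma after_rev L v x : after L (fun k => v (L - k)) x = before L v x.
Proof. by rewrite /before /after subnn subn0 !(distC x) addnC. Qed.

Lemma before_after L v x : 0 < L -> before L v x -> after L v x -> false.
Proof. by rewrite /before /after !(distC x); lia. Qed.

Variable M : nat.
Hypothesis M3 : 3 <= M.
Hypothesis order_ge : forall i j k,
  i != j -> 0 < k -> (cgen i * cgen j) ^+ k = 1 -> M <= k.

(** On the piece from [v i] to [v k], [project_ind] at [q := y] compares the distances of [z] and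
    [v i] to [y]; [up_dist] yields the same comparison at [v k]. *)
Lemma geod_through_up L v c z y i k : rigid M L c -> path_along L v c ->
  i + 16 <= k -> k <= L -> up v z i -> dist (v i) y = (k - i) + dist (v k) y ->
  dist z y = dist z (v k) + dist (v k) y.
Proof.
move=> hc hv ik kL ui hy.
have kiL : k - i <= L - i by lia.
have ek : i + (k - i) = k by lia.
have hv' := along_widen (along_shift hv (i := i)) kiL.
have hc' := rigid_widen kiL (rigid_shift i hc).
have k16 : 16 <= k - i by lia.
have u0 : up (fun k => v (i + k)) z 0 by rewrite /up addn0 addn1.
have := project_ind M3 order_ge hc' hv' k16 u0 (y := y) (q := y).
rewrite distxx !addn0 ek => /(_ hy erefl) [|_]; first by rewrite hy; lia.
have := up_dist M3 order_ge hc' hv' u0 (j := 6) (k := k - i).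
rewrite ek => /(_ isT) h1; have {}h1 := h1 ltac:(lia) (leqnn _).
rewrite (distC z y) (distC z); move: h1 hy k16; clear; lia.
Qed.

Lemma geod_through_down L v c z x i k : rigid M L c -> path_along L v c ->
  k + 15 <= i -> i < L -> ~~ up v z i ->
  dist (v i.+1) x = (i.+1 - k) + dist (v k) x ->
  dist z x = dist z (v k) + dist (v k) x.
Proof.
move=> hc hv ki iL ui hx.
have := geod_through_up (rigid_rev hc) (along_rev hv) (z := z) (y := x)
  (i := L - i.+1) (k := L - k).
rewrite (up_rev hv); last by lia.
have -> : L - (L - i.+1).+1 = i by lia.
have -> : L - (L - i.+1) = i.+1 by lia.
have -> : L - (L - k) = k by lia.
have -> : L - k - (L - i.+1) = i.+1 - k by lia.
by apply=> //; clear -ki iL; lia.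
Qed.

Section Cut.
Variables (L : nat) (v : nat -> cox m) (c : nat -> 'I_n) (x y : cox m).
Hypothesis hc : rigid M L c.
Hypothesis hv : path_along L v c.
Hypotheses (L40 : 40 <= L) (hx : before L v x) (hy : after L v y).

Let hx' : dist x (v L) = dist x (v 0) + L. Proof. exact/eqP. Qed.
Let hy' : dist (v 0) y = L + dist (v L) y. Proof. exact/eqP. Qed.

Lemma dist_before j : j <= L -> dist x (v j) = dist x (v 0) + j.
Proof. exact: (all_up hv hx'). Qed.

Lemma dist_after j : j <= L -> dist (v j) y = (L - j) + dist (v L) y.
Proof. exact: (all_down hv hy'). Qed.

Lemma dist_along j k : j <= k -> k <= L -> dist (v j) (v k) = k - j.
Proof.
move=> jk kL; have := along_dist hv jk kL; have := dist_tri (v j) x (v k).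
have := dist_before kL; have := dist_before (leq_trans jk kL); lia.
Qed.

Lemma geod_before_after j : j <= L -> dist x y = dist x (v j) + dist (v j) y.
Proof.
move=> jL; have ux : up v x 0.
  have := @dist_before 1; rewrite /up !(distC x); lia.
have := geod_through_up hc hv (k := L) (y := y) _ _ ux.
move=> h; have {h} := h ltac:(lia) (leqnn L); rewrite subn0 => /(_ hy') ->.
by have := dist_before jL; have := dist_before (leqnn L); have := dist_after jL; lia.
Qed.

(** If [q] goes up at [j - 2], its distance to [y] is realized through [v j]; if it goes down at
    [j.+1], its distance to [x] is. In the remaining case [q] is on a geodesic from [v 0] to [v L],
    hence on the path itself by [geod_prefix]. *)
Lemma cut_vertex j q : 20 <= j -> j + 20 <= L -> dist x y = dist x q + dist q y ->
  dist x (v j) = dist x q + dist q (v j) \/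
  dist x q = dist x (v j) + dist (v j) q.
Proof.
move=> j20 jL hq; have jL' : j <= L by lia.
have hj := geod_before_after jL'.
have toy i : i + 16 <= L -> up v q i -> dist q y = dist q (v L) + dist (v L) y.
  move=> iL ui; apply: (geod_through_up hc hv iL (leqnn L) ui).
  by rewrite dist_after; lia.
have tox i : 15 <= i -> i < L -> ~~ up v q i -> dist q x = dist q (v 0) + dist (v 0) x.
  move=> i15 iL ui; apply: (geod_through_down hc hv (k := 0) _ iL ui) => //.
  rewrite subn0 !(distC _ x) dist_before; lia.
have hyj := dist_after jL'; have hxj := dist_before jL'.
case u2 : (up v q (j - 2)).
  left; have := toy _ _ u2; have := up_dist M3 order_ge hc hv u2 (j := j) (k := L).
  by rewrite !(distC q) (distC y q); clear -j20 jL hq hj hyj; lia.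
case u1 : (up v q j.+1); last first.
  right; have := tox j.+1; rewrite u1 => h; have {h} := h ltac:(lia) ltac:(lia) isT.
  have := down_dist M3 order_ge hc hv (negbT u1) (j := 0) (k := j).
  by rewrite !(distC q) !(distC _ x); clear -j20 jL hq hj hxj; lia.
have y1 := toy j.+1 ltac:(clear -j20 jL; lia) u1.
have x1 := tox (j - 2) ltac:(clear -j20 jL; lia) ltac:(clear -j20 jL; lia) (negbT u2).
have hxL := dist_before (leqnn L).
have d1 := up_dist M3 order_ge hc hv u1 (j := j.+3) (k := L) (leqnn _)
  ltac:(clear -j20 jL; lia) (leqnn L).
have d2 := down_dist M3 order_ge hc hv (negbT u2) (j := 0) (k := j - 3)
  ltac:(clear -j20 jL; lia) ltac:(clear -j20 jL; lia) ltac:(clear -j20 jL; lia).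
have h0 := geod_before_after (leq0n L).
have h0L : dist (v 0) (v L) = dist (v 0) q + dist q (v L).
  rewrite dist_along // subn0.
  by move: hq h0 hy' y1 x1; rewrite !(distC q x) !(distC _ x) !(distC q (v 0)); clear; lia.
have eq : q = v (dist (v 0) q).
  apply: (geod_prefix M3 order_ge hc hv (y := v L) _ h0L).
    by rewrite distxx addn0 dist_along ?subn0.
  move: h0L d1 d2; rewrite dist_along // subn0 (distC q (v L)).
  by clear -j20 jL; lia.
move: h0L eq; rewrite dist_along // subn0; move: (dist (v 0) q) => d hd eq.
have dL : d <= L by clear -hd; lia.
rewrite eq; case: (leqP d j) => dj; [left|right]; rewrite (dist_before jL') (dist_before dL).
  by rewrite dist_along //; clear -dj; lia.
by rewrite dist_along //; clear -dj; lia.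
Qed.

End Cut.

(** Both [x] and [z] reach every point of [v'] through [v k], so their distances to [v'] differ by a
    constant. For [x] this holds because [v k] is a cut vertex and [v'] starts farther from [x]. *)
Lemma before_transfer L v c v' c' x y z i :
  rigid M L c -> path_along L v c -> rigid M L c' -> path_along L v' c' ->
  i + 40 <= L -> before L v x -> after L v y -> before L v' x -> after L v' y ->
  dist x (v 0) + L <= dist x (v' 0) -> up v z i -> before L v' z.
Proof.
move=> hc hv hc' hv' iL hx hy hx' hy' hd ui.
have L40 : 40 <= L by lia.
(* This leaves 20 letters after [k] for [cut_vertex] and 20 between [i] and [k], where
   [geod_through_up] asks for 16. *)
pose k := L - 20.
have key j : j <= L -> dist z (v' j) = dist z (v k) + dist (v k) (v' j) /\
                       dist x (v' j) = dist x (v k) + dist (v k) (v' j).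
  move=> jL; have hj := geod_before_after hc' hv' L40 hx' hy' jL.
  have ek := dist_before hv hx (j := k) ltac:(rewrite /k; lia).
  have ej := dist_before hv' hx' jL.
  have hxj : dist x (v' j) = dist x (v k) + dist (v k) (v' j).
    have k20 : 20 <= k by rewrite /k; lia.
    have kL : k + 20 <= L by rewrite /k; lia.
    case: (cut_vertex hc hv L40 hx hy k20 kL hj) => //.
    by move: ek ej hd kL; clear; lia.
  split=> //; have kL : k <= L by rewrite /k; lia.
  apply: (geod_through_up hc hv _ kL ui); first by rewrite /k; lia.
  have h1 := dist_tri (v i) x (v' j).
  have h2 := dist_tri (v k) (v i) (v' j).
  have ik : i <= k by rewrite /k; lia.
  have h3 := along_dist hv ik kL.
  have h4 := dist_before hv hx (j := i) ltac:(lia).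
  by move: h1 h2 h3 h4 ek hxj ik; clear; lia.
have [a1 b1] := key 0 (leq0n L); have [a2 b2] := key L (leqnn L).
by move: hx'; rewrite /before; move: a1 b1 a2 b2; clear; lia.
Qed.

Lemma after_transfer L v c v' c' x y z i :
  rigid M L c -> path_along L v c -> rigid M L c' -> path_along L v' c' ->
  40 <= i -> i < L -> before L v x -> after L v y -> before L v' x -> after L v' y ->
  dist x (v 0) + L <= dist x (v' 0) -> ~~ up v' z i -> after L v z.
Proof.
move=> hc hv hc' hv' i40 iL hx hy hx' hy' hd ui.
have L40 : 40 <= L by lia.
have := before_transfer (rigid_rev hc') (along_rev hv') (rigid_rev hc) (along_rev hv)
  (x := y) (y := x) (z := z) (i := L - i.+1).
rewrite !before_rev !after_rev (up_rev hv'); last by lia.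
have -> : L - (L - i.+1).+1 = i by lia.
rewrite !subn0; apply=> //; first by clear -i40 iL; lia.
have h1 := geod_before_after hc hv L40 hx hy (leqnn L).
have h2 := geod_before_after hc' hv' L40 hx' hy' (leqnn L).
move: hx hx'; rewrite /before => /eqP e1 /eqP e2.
by rewrite !(distC y); clear -h1 h2 e1 e2 hd; lia.
Qed.

End HalfSpaces.

(** * The counting function and its defect *)

Lemma size_window d L (s : seq nat) :
  uniq s -> (forall k, k \in s -> d <= k < d + L) -> size s <= L.
Proof.
move=> us hs; rewrite -(size_iota d L); apply: uniq_leq_size us _ => k /hs.
by rewrite mem_iota.
Qed.

(** One window starts at the minimum of [s], the other at the minimum of what lies beyond the
    first. *)
Lemma size_two_windows L (s : seq nat) : uniq s ->
  (forall a b c, a \in s -> b \in s -> c \in s -> a + L <= b -> b + L <= c -> False) ->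
  size s <= L + L.
Proof.
have low (t : seq nat) : t <> [::] -> exists2 d, d \in t & forall k, k \in t -> d <= k.
  case: t => // a t _; have ex : exists k, k \in a :: t.
    by exists a; rewrite inE eqxx.
  by case: (ex_minnP ex) => d; exists d.
have split (p : pred nat) (t : seq nat) : size t = size (filter p t) + size (filter (predC p) t).
  by rewrite !size_filter count_predC.
move=> us hs; case: (altP (s =P [::])) => [-> //|/eqP /low[d ds dmin]].
rewrite (split (fun k => k < d + L)) leq_add //.
  apply: (size_window (d := d)); first exact: filter_uniq.
  by move=> k; rewrite mem_filter => /andP[-> /dmin ->].
set t := filter _ s; case: (altP (t =P [::])) => [-> //|/eqP /low[e es emin]].
apply: (size_window (d := e)); first exact: filter_uniq.
move=> k ks; rewrite emin //= ltnNge; apply/negP.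
move: es ks; rewrite /t !mem_filter /= -!leqNgt => /andP[de es] /andP[_ ks].
exact: hs ds es ks de.
Qed.

Section Counting.
Variables (n : nat) (m : 'I_n -> 'I_n -> option nat) (M : nat).
Hypothesis M3 : 3 <= M.
Hypothesis order_ge : forall i j k,
  i != j -> 0 < k -> (cgen m i * cgen m j) ^+ k = 1 -> M <= k.
Variables (c : nat -> 'I_n) (L : nat).
Hypothesis hc : forall N, rigid M N c.
Hypothesis L80 : 80 <= L.
Implicit Types (x y z q u g : cox m).

Local Notation cgen := (cgen m).

Definition pt u k : cox m := u * elt m (mkseq c k).

Lemma pt0 u : pt u 0 = u.
Proof. exact: mulg1. Qed.

Lemma ptS u k : pt u k.+1 = pt u k * cgen (c k).
Proof. by rewrite /pt mkseqS -cats1 elt_cat mulgA. Qed.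

Lemma pt_mul g u k : pt (g * u) k = g * pt u k.
Proof. by rewrite /pt mulgA. Qed.

Lemma pt_path N u : path_along N (pt u) c.
Proof. by move=> k _; apply: ptS. Qed.

Definition between x y u : bool := before L (pt u) x && after L (pt u) y.

Lemma between_mul g x y u : between (g * x) (g * y) (g * u) = between x y u.
Proof. by rewrite /between /before /after !pt_mul !dist_mul. Qed.

Lemma between_geod x y u j : between x y u -> j <= L ->
  dist x y = dist x (pt u j) + dist (pt u j) y.
Proof.
case/andP => hx hy jL.
by apply: (geod_before_after M3 order_ge (hc L) (@pt_path L u) _ hx hy jL); lia.
Qed.

Definition ball r : seq (cox m) := undup
  [seq elt m w | w <- flatten [seq [seq val t | t : k.-tuple 'I_n] | k <- iota 0 r.+1]].

Lemma mem_ball r u : len u <= r -> u \in ball r.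
Proof.
case: (len_word u) => w <- sw lw; rewrite mem_undup; apply: map_f.
apply/flattenP; exists [seq val t | t : (size w).-tuple 'I_n].
  by apply/mapP; exists (size w) => //; rewrite mem_iota; lia.
by apply/mapP; exists (in_tuple w) => //; rewrite mem_enum.
Qed.

(** Every [u] between [x] and [y] lies on a geodesic from [x] to [y], so this finite list contains
    them all even when the group is infinite. *)
Definition cnt x y : nat := count (between x y) [seq x * u | u <- ball (dist x y)].

Lemma cnt_mul g x y : cnt (g * x) (g * y) = cnt x y.
Proof.
rewrite /cnt dist_mul !count_map; apply: eq_count => u /=.
by rewrite -mulgA between_mul.
Qed.

Lemma uniq_sphere x y : uniq [seq x * u | u <- ball (dist x y)].
Proof. by rewrite (map_inj_uniq (mulgI x)) undup_uniq. Qed.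

Lemma mem_sphere x y u : between x y u -> u \in [seq x * u | u <- ball (dist x y)].
Proof.
move=> hu; apply/mapP; exists (x^-1 * u); last by rewrite mulVKg.
by apply: mem_ball; have := between_geod hu (leq0n L); rewrite pt0 /dist; lia.
Qed.

Lemma cntE x y U : uniq U -> (forall u, between x y u -> u \in U) ->
  cnt x y = count (between x y) U.
Proof.
move=> uU hU; rewrite /cnt -!size_filter; apply: perm_size; apply: uniq_perm.
- by rewrite filter_uniq ?uniq_sphere.
- by rewrite filter_uniq.
move=> u; rewrite !mem_filter; case hu: (between x y u) => //=.
by rewrite mem_sphere // hU.
Qed.

Lemma cnt_ge x y (s : seq (cox m)) : uniq s -> all (between x y) s -> size s <= cnt x y.
Proof.
move=> us /allP hs; rewrite /cnt -size_filter; apply: uniq_leq_size us _ => u /hs hu.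
by rewrite mem_filter hu mem_sphere.
Qed.

(** The points [pt u 20] and [pt u' 20] are equally far from [x], and [cut_vertex] puts one of them
    on a geodesic from [x] to the other. *)
Lemma between_inj x y u u' : between x y u -> between x y u' ->
  dist x u = dist x u' -> u = u'.
Proof.
move=> hu hu' e; have L20 : 20 <= L by lia.
have L2020 : 20 + 20 <= L by lia.
have L40 : 40 <= L by lia.
have [hx hy] := andP hu; have [hx' hy'] := andP hu'.
have d1 := dist_before (@pt_path L u) hx L20.
have d2 := dist_before (@pt_path L u') hx' L20.
rewrite !pt0 in d1 d2.
have := cut_vertex M3 order_ge (hc L) (@pt_path L u) L40 hx hy (leqnn 20) L2020
  (between_geod hu' L20).
move=> h; have {h} /dist0 /mulIg // : dist (pt u 20) (pt u' 20) = 0.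
by case: h; rewrite ?(distC (pt u' 20)); move: d1 d2 e; clear; lia.
Qed.

Definition separated x y z u : bool :=
  [&& between x y u, ~~ before L (pt u) z & ~~ after L (pt u) z].

(** By [between_inj] it is enough to count distances to [x]. Of three paths starting at least [L]
    apart, the direction of [z] along the middle one puts it before the last or after the first. *)
Lemma count_separated x y z U : uniq U -> count (separated x y z) U <= L + L.
Proof.
move=> uU; rewrite -size_filter -(size_map (dist x)).
have inT u : u \in filter (separated x y z) U -> separated x y z u.
  by rewrite mem_filter => /andP[].
apply: size_two_windows.
  rewrite map_inj_in_uniq ?filter_uniq // => u u' /inT/and3P[hu _ _] /inT/and3P[hu' _ _].
  exact: between_inj hu hu'.
move=> d0 d d1 /mapP[u0 /inT/and3P[h0 _ a0] ->] /mapP[u /inT/and3P[hu _ _] ->].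
move=> /mapP[u1 /inT/and3P[h1 b1 _] ->] d01 d12.
have [x0 y0] := andP h0; have [x1 y1] := andP h1; have [xu yu] := andP hu.
(* The index 40 meets the margins of both transfer lemmas because [80 <= L]. *)
case hz: (up (pt u) z 40).
  case/negP: b1; apply: (before_transfer M3 order_ge (hc L) (@pt_path L u) (hc L)
    (@pt_path L u1) _ xu yu x1 y1 _ hz); first by lia.
  by rewrite !pt0.
case/negP: a0; apply: (after_transfer M3 order_ge (hc L) (@pt_path L u0) (hc L)
  (@pt_path L u) (leqnn 40) _ x0 y0 xu yu _ (negbT hz)); first by lia.
by rewrite !pt0.
Qed.

(** The inequality holds for each [u]: if [x], [y], [z] are all before or after the path, both sides
    agree, and an excess on the left occurs only if one of them is neither, which [separated]
    counts. Three such counts of at most [L + L] make [6 * L]. *)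
Lemma cnt_defect x y z :
  cnt x y + cnt y z + cnt z x <= cnt y x + cnt z y + cnt x z + 6 * L.
Proof.
pose U := undup (flatten [seq [seq p.1 * u | u <- ball (dist p.1 p.2)] |
  p <- [:: (x, y); (y, z); (z, x); (y, x); (z, y); (x, z)]]).
have uU : uniq U by apply: undup_uniq.
have E a b : (a, b) \in [:: (x, y); (y, z); (z, x); (y, x); (z, y); (x, z)] ->
    cnt a b = count (between a b) U.
  move=> hab; apply: cntE => // u /mem_sphere hu; rewrite mem_undup.
  by apply/flatten_mapP; exists (a, b).
rewrite !E ?inE ?eqxx ?orbT //.
have := count_separated x y z uU; have := count_separated y z x uU.
have := count_separated z x y uU.
suff : count (between x y) U + count (between y z) U + count (between z x) U <=
  count (between y x) U + count (between z y) U + count (between x z) U +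
  (count (separated x y z) U + count (separated y z x) U + count (separated z x y) U).
  by clear; lia.
elim: (U) => //= u V; move: (count _ V) (count _ V) (count _ V).
have L0 : 0 < L by lia.
have hx := @before_after _ _ _ (pt u) x L0; have hy := @before_after _ _ _ (pt u) y L0.
have hz := @before_after _ _ _ (pt u) z L0.
rewrite /separated /between; move: hx hy hz.
by do 3!(case: (before _ _ _); case: (after _ _ _)) => //=;
  try (by move=> /(_ isT isT)); try (by move=> _ /(_ isT isT));
  try (by move=> _ _ /(_ isT isT)); move=> _ _ _ *; lia.
Qed.

(** Induction by the defect of the triangle [1], [a * g], [a]. Translation by the involution [a]
    gives [cnt 1 a = cnt a 1], so each reflection costs only the defect. *)
Lemma cnt_reflections (ts : seq (word n)) :
  (forall t, List.In t ts -> is_reflection m t) ->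
  cnt 1 (elt m (flatten ts)) <= cnt (elt m (flatten ts)) 1 + size ts * (6 * L).
Proof.
elim: ts => [|t ts IH] hts; first by rewrite addn0.
have {IH} := IH (fun t' h => hts t' (or_intror h)).
have [x [s /eltP et]] := hts t (or_introl erefl).
set a := elt m t; set g := elt m (flatten ts).
have -> : elt m (flatten (t :: ts)) = a * g by apply: elt_cat.
have a2 : a * a = 1.
  by rewrite /a et !elt_cat elt_rev -/(cgen s) !mulgA mulgVK -(mulgA (elt m x)) cgen2 mulg1 mulgV.
have eVa : cnt 1 a = cnt a 1 by rewrite -(cnt_mul a 1 a) a2 mulg1.
have e1 : cnt (a * g) a = cnt g 1 by rewrite -{2}(mulg1 a) cnt_mul.
have e2 : cnt a (a * g) = cnt 1 g by rewrite -{1}(mulg1 a) cnt_mul.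
have := cnt_defect 1 (a * g) a.
by rewrite e1 e2 eVa [size _]/= (mulSn (size ts)); lia.
Qed.

End Counting.

(** * Growth along the periodic word *)

Section Growth.
Variables (n : nat) (m : 'I_n -> 'I_n -> option nat) (M : nat).
Hypothesis M3 : 3 <= M.
Hypothesis order_ge : forall i j k,
  i != j -> 0 < k -> (cgen m i * cgen m j) ^+ k = 1 -> M <= k.
Variables (c : nat -> 'I_n) (L : nat).
Hypothesis hc : forall N, rigid M N c.
Hypothesis L80 : 80 <= L.
Hypothesis c_mod : forall i j, c i = c j <-> i = j %[mod n].
Hypothesis n3 : 3 <= n.
Implicit Types (x y z q u g : cox m).

Local Notation cgen := (cgen m).
Local Notation pt := (@pt n m c).
Local Notation cnt := (@cnt n m c L).

Lemma cgen_mul_eq1 i j : cgen i * cgen j = 1 -> i = j.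
Proof.
move=> e; apply/eqP/negPn/negP => hij.
by have := order_ge hij (ltn0Sn 0) e; lia.
Qed.

(** Seen from the start the first two steps go up, as their letters differ, and [up_up] propagates
    this. *)
Lemma dist_pt0 N : dist (pt 1 0) (pt 1 N) = N.
Proof.
have hv K := @pt_path n m c K 1.
have ups k : up (pt 1) (pt 1 0) k && up (pt 1) (pt 1 0) k.+1.
  elim: k => [|k /andP[u0 u1]]; last first.
    rewrite u1 /=; move: u0 u1; rewrite !(up_desc_along (hv k.+3)); try lia.
    exact: (up_up M3 order_ge (hc k.+3) (g := fun k => (pt 1 k)^-1 * pt 1 0)
      (seq_along (hv k.+3) (pt 1 0))).
  have u0 := up_start (hv 2) isT; rewrite u0 /=.
  have := along_step (hv 2) (pt 1 0) (isT : 1 < 2).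
  have := along_step (hv 2) (pt 1 0) (isT : 0 < 2).
  move: u0; rewrite /up distxx => _ [] // e1 [] e2; first by lia.
  have : dist (pt 1 2) (pt 1 0) = 0 by lia.
  move/dist0; rewrite !ptS pt0 mul1g => /cgen_mul_eq1 /c_mod.
  by rewrite !modn_small; lia.
rewrite distC; elim: N => [|N IH]; first exact: distxx.
have := along_step (hv N.+1) (pt 1 0) (ltnSn N).
by have /andP[] := ups N; rewrite /up IH; lia.
Qed.

Lemma dist1_pt N : dist 1 (pt 1 N) = N.
Proof. by have := dist_pt0 N; rewrite pt0. Qed.

Lemma dist_pt i j : i <= j -> dist (pt 1 i) (pt 1 j) = j - i.
Proof.
move=> ij; have := along_dist (@pt_path n m c j 1) ij (leqnn j).
have := dist_tri (pt 1 i) 1 (pt 1 j); rewrite !dist1_pt; lia.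
Qed.

Lemma c_addl k i : c (n * k + i) = c i.
Proof. by apply/c_mod; rewrite mulnC modnMDl. Qed.

Lemma pt_add k i : pt (pt 1 (n * k)) i = pt 1 (n * k + i).
Proof.
elim: i => [|i IH]; first by rewrite pt0 addn0.
by rewrite addnS !ptS IH c_addl.
Qed.

(** By periodicity a copy of the path starts at each [pt 1 (n * a)]; for [a < lam - L] it ends by
    [n * lam], since [L <= n * L]. *)
Lemma cnt_lower lam : lam - L <= cnt 1 (pt 1 (n * lam)).
Proof.
pose s := [seq pt 1 (n * a) | a <- iota 0 (lam - L)].
have -> : lam - L = size s by rewrite size_map size_iota.
apply: (cnt_ge M3 order_ge hc L80).
  rewrite map_inj_uniq ?iota_uniq // => a b e.
  have := dist1_pt (n * b); rewrite -e dist1_pt => /eqP.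
  by rewrite eqn_pmul2l => [/eqP|]; lia.
apply/allP => _ /mapP[a ha ->]; move: ha; rewrite mem_iota add0n => /andP[_ ha].
have hL : n * a + L <= n * lam.
  have : n * (a + L) <= n * lam by rewrite leq_mul2l; lia.
  rewrite mulnDr; suff : L <= n * L by lia.
  by rewrite leq_pmull; lia.
rewrite /between /before /after !pt_add addn0 !dist1_pt !dist_pt; lia.
Qed.

(** Prolonging the path 6 letters beyond [N] provides the margin of [geod_prefix]. *)
Lemma geod_pt N q : N = dist 1 q + dist q (pt 1 N) -> q = pt 1 (dist 1 q).
Proof.
move=> hq; have h6 := dist_pt (leq_addr 6 N).
have h1 := dist_tri (pt 1 N) q (pt 1 (N + 6)).
have h2 := dist_tri q 1 (pt 1 (N + 6)); rewrite dist1_pt in h2.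
have := geod_prefix M3 order_ge (hc (N + 6)) (@pt_path _ _ c _ 1)
  (y := pt 1 (N + 6)) (q := q).
by rewrite distxx addn0 pt0 dist1_pt; apply=> //; lia.
Qed.

(* A point of [between] on the way back would show a segment of the word read
   backwards, but [c 0], [c 1] never follow each other in this order there. *)
Lemma cnt_back lam : cnt (pt 1 (n * lam)) 1 = 0.
Proof.
apply/eqP; rewrite -leqn0 leqNgt -has_count; apply/hasPn => u _; apply/negP => hu.
have [_ hafter] := andP hu; set N := (n * lam)%N in hu.
have e0 : dist u 1 = L + dist (pt u L) 1 by move: hafter; rewrite /after pt0 => /eqP.
have onpath j : j <= L -> pt u j = pt 1 (dist u 1 - j).
  move=> jL; have := between_geod M3 order_ge hc L80 hu jL.
  rewrite distC dist1_pt (distC _ (pt u j)) (distC _ 1) addnC => /geod_pt hg.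
  rewrite {1}hg; congr (pt 1 _).
  have := all_down (@pt_path _ _ c L u) (y := 1) _ jL.
  by rewrite pt0 (distC 1) => /(_ e0) ->; lia.
have letters j : j < L -> c j = c (dist u 1 - j.+1).
  move=> jL; apply/esym/cgen_mul_eq1; have := onpath _ jL.
  rewrite ptS onpath; last by lia.
  have -> : dist u 1 - j = (dist u 1 - j.+1).+1 by lia.
  by rewrite ptS -mulgA => /eqP; rewrite -{2}[pt 1 _]mulg1 (inj_eq (mulgI _)) => /eqP ->.
(* With [D] the distance from [u] to 1, [0 = D - 1] and [1 = D - 2] modulo [n] give [2 = 0], against
   [3 <= n]. *)
have [/c_mod d0 /c_mod d1] := (letters 0 ltac:(lia), letters 1%N ltac:(lia)).
have ed : dist u 1 - 1%N = (dist u 1 - 2).+1 by lia.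
have := modnDml (dist u 1 - 2) 1 n; rewrite -d1 (addn1 (_ - _)) -ed -d0 modnDml.
by rewrite !modn_small; lia.
Qed.

End Growth.

(** * Coxeter elements and the conclusion *)

Section CoxeterElement.
Variables (n : nat) (sigma : 'S_n.+1).

Definition coxeter_letter (k : nat) : 'I_n.+1 := sigma (inZp k).

Lemma coxeter_letter_mod i j :
  coxeter_letter i = coxeter_letter j <-> i = j %[mod n.+1].
Proof.
split=> [/perm_inj /(congr1 val) //|e].
by congr (sigma _); apply: val_inj.
Qed.

Lemma wpow_coxeter_element k :
  wpow (coxeter_element sigma) k = mkseq coxeter_letter (n.+1 * k).
Proof.
elim: k => [|k IH]; first by rewrite muln0.
rewrite /wpow /= -/(wpow _ k) IH mulnS /mkseq iotaD map_cat; congr (_ ++ _).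
  rewrite -val_enum_ord -map_comp; apply: eq_map => i /=.
  by congr (sigma _); apply: val_inj; rewrite /= modn_small.
rewrite add0n -[LHS](eq_map (f := coxeter_letter \o addn n.+1)); last first.
  by move=> i; apply/coxeter_letter_mod; rewrite modnDl.
by rewrite map_comp -iotaDl addn0.
Qed.

Lemma coxeter_letter_rigid M N :
  3 <= n.+1 -> (4 <= M \/ 4 <= n.+1) -> rigid M N coxeter_letter.
Proof.
have sep i k : 0 < k < n.+1 -> coxeter_letter i != coxeter_letter (k + i).
  move=> hk; apply/eqP => /coxeter_letter_mod/eqP; rewrite -{1}(add0n i) eqn_modDr.
  by rewrite !modn_small; lia.
move=> n3 h; split=> [i _|i _|]; first by apply: (sep i 1%N); lia.
  by apply: (sep i 2); lia.
by case: h => h; [left | right=> i _; apply: (sep i 3); lia].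
Qed.

End CoxeterElement.

(** Infinite entries get order 5 in the representation, whence [M <= 5]. *)
Lemma order_ge_of_entries n (m : 'I_n -> 'I_n -> option nat) M :
  coxeter_matrix m -> M <= 5 -> (forall i j, i != j -> entry_ge M (m i j)) ->
  forall i j k, i != j -> 0 < k -> (cgen m i * cgen m j) ^+ k = 1 -> M <= k.
Proof.
move=> hm M5 hM i j k hij k0 /(cgen_mul_order hm hij) /(dvdn_leq k0).
apply: leq_trans; have := hM i j hij; rewrite /entry.
by case: (m i j).
Qed.

Local Close Scope group_scope.

Theorem theorem1 (n : nat) (m : 'I_n -> 'I_n -> option nat)
  (hm : coxeter_matrix m) (sigma : 'S_n) :
  ((n = 3 /\ forall i j : 'I_n, i != j -> entry_ge 5 (m i j)) \/
   (4 <= n /\ forall i j : 'I_n, i != j -> entry_ge 3 (m i j))) ->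
  forall N : nat, exists L : nat, forall lam : nat, L <= lam ->
    N <= refl_length m (wpow (coxeter_element sigma) lam).
Proof.
move=> hyp; have [M [M3 M5 n3 hMn hM]] : exists M,
    [/\ 3 <= M, M <= 5, 3 <= n, 4 <= M \/ 4 <= n &
        forall i j : 'I_n, i != j -> entry_ge M (m i j)].
  case: hyp => [[n3 h]|[n4 h]]; first by exists 5; split=> //; [rewrite n3 | left].
  by exists 3; split=> //; [apply: ltnW | right].
have order_ge := order_ge_of_entries hm M5 hM.
case: n => [|n] // in m hm sigma {hyp} n3 hMn hM order_ge *.
have hc N := coxeter_letter_rigid sigma N n3 hMn.
(* From here on the count [lam - 80] is at least [N * (6 * 80)], while [q] reflections account for
   at most [q * (6 * 80)]. *)
move=> N; exists (N * (6 * 80) + 80) => lam hlam.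
rewrite /refl_length; case: ex_minnP => q.
case: excluded_middle_informative => // hq _ _.
have [ts [<- [hts /eltP e]]] := hq.
have := cnt_reflections M3 order_ge hc (leqnn 80) hts; rewrite -e wpow_coxeter_element.
have := cnt_lower M3 order_ge hc (leqnn 80) (coxeter_letter_mod sigma) n3 lam.
have := cnt_back M3 order_ge hc (leqnn 80) (coxeter_letter_mod sigma) n3 lam.
rewrite /pt mul1g => -> h1 h2.
suff : N * (6 * 80) <= size ts * (6 * 80) by rewrite leq_pmul2r.
by lia.
Qed.
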